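(* Let $\Psi$ be an affine flow on $B\times H$ with central Selgrade bundle $\mathcal{V}_c^1$ in $B\times H^1$, and let $\mathcal{M}_c^1=\mathbb{P}\mathcal{V}_c^1\subset B\times\mathbb{P}H^1$. Let $h^1:B\times H\to B\times\mathbb{P}H^{1,1}$, $h^1(b,x)=(b,\mathbb{P}(x,1))$. (i) If $(b,x)\in B\times H$ is chain recurrent for $\Psi$, then $h^1(b,x)\in\mathcal{M}_c^1$. (ii) The inclusion $\mathcal{M}_c^1\subset B\times\mathbb{P}H^{1,1}$ holds if and only if $$\mathcal{N}_c:=(h^1)^{-1}\big(\mathcal{M}_c^1\cap(B\times\mathbb{P}H^{1,1})\big)$$ is compact. In this case $\mathcal{N}_c=(h^1)^{-1}(\mathcal{M}_c^1)$ is the chain recurrent set of $\Psi$.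
   Context: Flows and chains: A flow on a metric space $X$ is a continuous map $\Phi:\mathbb{R}\times X\to X$ with $\Phi_0=\mathrm{id}$, $\Phi_{t+s}=\Phi_t\circ\Phi_s$. For $\varepsilon,T>0$ an $(\varepsilon,T)$-chain from $x$ to $y$ consists of $n\ge1$, $T_0,\dots,T_{n-1}\ge T$ and $x_0=x,x_1,\dots,x_n=y\in X$ with $d(\Phi_{T_i}(x_i),x_{i+1})<\varepsilon$ for $i=0,\dots,n-1$. A point $x$ is chain recurrent if for all $\varepsilon,T>0$ there is an $(\varepsilon,T)$-chain from $x$ to $x$; the chain recurrent set is the set of all chain recurrent points. A set $Y\subset X$ is chain transitive if for all $x,y\in Y$ and all $\varepsilon,T>0$ there is an $(\varepsilon,T)$-chain from $x$ to $y$. A chain recurrent component is a maximal chain transitive set. Linear flows and Selgrade's theorem: $B$ is a compact metric space with a chain transitive flow $\theta$ and $H$ is a real Hilbert space of finite dimension $d$. A linear flow on $B\times H$ is a flow $\Phi_t(b,x)=(\theta_tb,\varphi(t,b,x))$ with $\varphi(t,b,\cdot)$ linear. A subbundle is a closed subset of $B\times H$ intersecting each fiber $\{b\}\times H$ in a linear subspace of constant dimension. $\mathbb{P}$ denotes the projections $H\setminus\{0\}\to\mathbb{P}H$ and $B\times(H\setminus\{0\})\to B\times\mathbb{P}H$ (for a subbundle $\mathcal{V}$, $\mathbb{P}\mathcal{V}$ is the image of its points with nonzero fiber component). $\mathbb{P}H$ has the metric $d(\mathbb{P}x,\mathbb{P}y)=\min\{\|\frac{x}{\|x\|}-\frac{y}{\|y\|}\|,\|\frac{x}{\|x\|}+\frac{y}{\|y\|}\|\}$;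 products with $B$ (also $B\times H$) have the maximum metric. $\Phi$ induces a flow $\mathbb{P}\Phi$ on $B\times\mathbb{P}H$. Selgrade's theorem: $\mathbb{P}\Phi$ has finitely many chain recurrent components $\mathcal{M}_1,\dots,\mathcal{M}_\ell$; the sets $\mathcal{V}_i=\{(b,x)\mid x\ne0\Rightarrow(b,\mathbb{P}x)\in\mathcal{M}_i\}$ are subbundles, called the Selgrade bundles, and $B\times H=\mathcal{V}_1\oplus\dots\oplus\mathcal{V}_\ell$. Affine flows: An affine flow on $B\times H$ is a continuous map $\Psi=(\theta,\psi)$ for which there are a linear flow $\Phi=(\theta,\varphi)$ (the linear part) and $f:B\to L^\infty(\mathbb{R},H)$ with $f(b)(t+s)=f(\theta_sb)(t)$ for all $b$ and almost all $t,s$, and $\psi(t,b,x)=\varphi(t,b,x)+\int_0^t\varphi(t-s,\theta_sb,f(b)(s))\,ds$. Its lift is the linear flow on $B\times H^1$, $H^1=H\times\mathbb{R}$ (product Hilbert norm), given by $\Psi^1_t(b,x,r)=(\theta_tb,\varphi(t,b,x)+r\int_0^t\varphi(t-s,\theta_sb,f(b)(s))\,ds,r)$. Notation: $\mathbb{P}H^{1,1}=\{\mathbb{P}(x,r)\mid x\in H,r\neq0\}$, $H^{1,1}=H\times(\mathbb{R}\setminus\{0\})$. There is a unique Selgrade bundle of $\Psi^1$ that intersects $B\times H^{1,1}$; it is called the central Selgrade bundle and denoted $\mathcal{V}_c^1$. *)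

(* Defs.v *)
From HB Require Import structures.
From mathcomp Require Import all_boot all_order all_algebra.
From mathcomp Require Import sesquilinear.
From mathcomp Require Import all_classical all_reals all_analysis.
From mathcomp Require Import ring lra.
Set Implicit Arguments.
Unset Strict Implicit.
Unset Printing Implicit Defensive.
Import Order.TTheory GRing.Theory Num.Theory.
Import numFieldNormedType.Exports.
Local Open Scope classical_set_scope.
Local Open Scope ring_scope.

(* The balls of the library's product pseudometric are those of the maximum
   metric. *)
Section prod_metric.
Context {R : numFieldType} {U V : metricType R}.
Implicit Types p q : U * V.

Definition prod_mdist p q : R := Num.max (mdist p.1 q.1) (mdist p.2 q.2).

Let prod_mdist_ge0 p q : 0 <= prod_mdist p q.
Proof. by rewrite /prod_mdist /Order.max; case: ifP; rewrite mdist_ge0. Qed.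

Let prod_mdistP p q d :
  (prod_mdist p q < d) = (mdist p.1 q.1 < d) && (mdist p.2 q.2 < d).
Proof.
apply: comparable_gt_max; apply: real_comparable; exact: ger0_real (mdist_ge0 _ _).
Qed.

Let prod_mdist_positivity p q : prod_mdist p q = 0 -> p = q.
Proof.
move=> pq0; have h (x : R) : 0 <= x -> (forall d, 0 < d -> x < d) -> x = 0.
  move=> x0 hx; apply/eqP; rewrite eq_le x0 andbT.
  by case/comparable_leP: (real_comparable (ger0_real x0) (ger0_real (lexx 0))) => // /hx; rewrite ltxx.
have {}pq0 d : 0 < d -> (mdist p.1 q.1 < d) && (mdist p.2 q.2 < d).
  by move=> d0; rewrite -prod_mdistP pq0.
case: p q pq0 => [a b] [c d] /= pq0; congr pair; apply: mdist_positivity;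
  by apply: h; rewrite ?mdist_ge0// => e /pq0/andP[].
Qed.

Let prod_ballEmdist p d : ball p d = [set q | prod_mdist p q < d].
Proof.
apply/seteqP; split => q /=.
  by move=> -[]; rewrite !ballEmdist/= prod_mdistP => -> ->.
by rewrite prod_mdistP => /andP[h1 h2]; split; rewrite ballEmdist.
Qed.

HB.instance Definition _ := PseudoMetric_isMetric.Build R (U * V)%type
  prod_mdist_ge0 prod_mdist_positivity prod_ballEmdist.

End prod_metric.

HB.mixin Record isFinHilbert (R : realType) V
    & Metric R V & NormedModule R V & Vector R V := {
  inner : {dot V for idfun} ;
  normr_inner : forall x : V, `|x| = Num.sqrt (inner x x) ;
  mdist_norm : forall x y : V, mdist x y = `|x - y|
}.

#[short(type="finHilbertType")]
HB.structure Definition FinHilbert (R : realType) :=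
  {V of Metric R V & NormedModule R V & Vector R V & isFinHilbert R V}.

HB.factory Record Vector_isFinHilbert (R : realType) V & Vector R V := {
  inner : {dot V for idfun}
}.

HB.builders Context R V & Vector_isFinHilbert R V.

Let nrm (x : V) : R := Num.sqrt (inner x x).

Let innerC x y : inner x y = inner y x.
Proof. by rewrite (@hermitian_subproof _ _ _ _ inner) expr0 mul1r. Qed.

Let inner0r x : inner x 0 = 0. Proof. exact: linear0r. Qed.

Let inner_ge0 x : 0 <= inner x x.
Proof.
have [->|x0] := eqVneq x 0; first by rewrite inner0r.
exact/ltW/neq0_dnorm_gt0.
Qed.

Let innerDr x y z : inner x (y + z) = inner x y + inner x z.
Proof. exact: linearDr. Qed.

Let innerDl x y z : inner (x + y) z = inner x z + inner y z.
Proof. by rewrite innerC innerDr !(innerC z). Qed.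

Let innerZr a x y : inner x (a *: y) = a * inner x y.
Proof. by rewrite linearZr_LR. Qed.

Let innerZl a x y : inner (a *: x) y = a * inner x y.
Proof. by rewrite innerC innerZr innerC. Qed.

Let cauchy_schwarz x y : inner x y ^+ 2 <= inner x x * inner y y.
Proof.
have [->|y0] := eqVneq y 0; first by rewrite !inner0r mulr0 expr0n.
have yy := neq0_dnorm_gt0 y y0 : 0 < inner y y.
have := inner_ge0 (inner y y *: x + (- inner x y) *: y).
rewrite !(innerDr, innerDl, innerZr, innerZl) (innerC y x).
set a := inner x x; set b := inner x y; set c := inner y y => h.
have {h} : 0 <= c * (a * c - b ^+ 2) by move: h; congr (_ <= _); ring.
by rewrite pmulr_rge0// subr_ge0.
Qed.

Let nrm_ge0 x : 0 <= nrm x. Proof. exact: sqrtr_ge0. Qed.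

Let sqr_nrm x : nrm x ^+ 2 = inner x x.
Proof. by rewrite sqr_sqrtr// inner_ge0. Qed.

Let ler_nrmD x y : nrm (x + y) <= nrm x + nrm y.
Proof.
rewrite -(@ler_pXn2r _ 2)// ?nnegrE ?addr_ge0//.
rewrite sqrrD !sqr_nrm innerDr !innerDl (innerC y x).
have : inner x y <= nrm x * nrm y.
  apply: le_trans (ler_norm _) _.
  by rewrite -sqrtr_sqr -sqrtrM// ler_wsqrtr// cauchy_schwarz.
lra.
Qed.

Let nrmZ a x : nrm (a *: x) = `|a| * nrm x.
Proof.
by rewrite /nrm innerZl innerZr mulrA -expr2 sqrtrM ?sqr_ge0// sqrtr_sqr.
Qed.

Let nrm0_eq0 x : nrm x = 0 -> x = 0.
Proof.
move=> x0; apply/eqP/negPn/negP => /(@neq0_dnorm_gt0 _ _ _ inner x).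
by rewrite -sqr_nrm x0 expr0n ltxx.
Qed.

HB.instance Definition _ := Lmodule_isNormed.Build R V ler_nrmD nrmZ nrm0_eq0.

Let dist (x y : V) : R := `|x - y|.

Let dist_ge0 x y : 0 <= dist x y. Proof. exact: normr_ge0. Qed.

Let dist_positivity x y : dist x y = 0 -> x = y.
Proof. by move/normr0_eq0/eqP; rewrite subr_eq0 => /eqP. Qed.

Let ballEdist (x : V) d : ball x d = [set y | dist x y < d].
Proof. by rewrite -ball_normE. Qed.

HB.instance Definition _ :=
  PseudoMetric_isMetric.Build R V dist_ge0 dist_positivity ballEdist.

HB.instance Definition _ := isFinHilbert.Build R V
  (fun=> erefl) (fun _ _ => erefl).

HB.end.

(* H x R with the product Hilbert norm (the norm that the library puts on
   [H * R] is the maximum norm, hence the alias). *)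
Definition hext (R : realType) (H : finHilbertType R) : Type := (H * R)%type.

Section hext.
Context {R : realType} {H : finHilbertType R}.

HB.instance Definition _ := Vector.copy (hext H) (H * R^o)%type.

Definition hext_inner (z w : hext H) : R := inner z.1 w.1 + z.2 * w.2.

Let hext_innerC z w : hext_inner z w = hext_inner w z.
Proof.
by rewrite /hext_inner mulrC (@hermitian_subproof _ _ _ _ inner) expr0 mul1r.
Qed.

Let hext_inner_linear z : linear_for *%R (hext_inner z).
Proof.
move=> a u v; rewrite /hext_inner /= linearDr linearZr_LR /=.
by rewrite /GRing.scale /=; ring.
Qed.

Let hext_inner_bilinear : bilinear_for *%R *%R hext_inner.
Proof.
split=> z; last exact: hext_inner_linear.
by move=> a u v; rewrite hext_innerC hext_inner_linear !(hext_innerC z).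
Qed.

HB.instance Definition _ :=
  bilinear_isBilinear.Build R (hext H) (hext H) R *%R (idfun \; *%R)
    hext_inner hext_inner_bilinear.

Let hext_inner_hermitian (z w : hext H) :
  hext_inner z w = (-1) ^+ false * idfun (hext_inner w z).
Proof. by rewrite expr0 mul1r hext_innerC. Qed.

HB.instance Definition _ :=
  isHermitianSesquilinear.Build R (hext H) false idfun hext_inner
    hext_inner_hermitian.

Let hext_inner_gt0 (z : hext H) : z != 0 -> 0 < hext_inner z z.
Proof.
have inner_ge0 (x : H) : 0 <= inner x x.
  have [->|/neq0_dnorm_gt0/ltW//] := eqVneq x 0.
  by rewrite (linear0r inner).
case: z => x r; rewrite /hext_inner /= => xr0.
have [x0|x0] := eqVneq x 0; last first.
  by rewrite ltr_pwDl// ?(@neq0_dnorm_gt0 _ _ _ inner x)// -expr2 sqr_ge0.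
rewrite ltr_wpDl// -expr2 exprn_even_gt0//=.
by apply: contraNneq xr0 => r0; rewrite x0 r0.
Qed.

HB.instance Definition _ := isDotProduct.Build R (hext H) hext_inner
  hext_inner_gt0.

HB.instance Definition _ :=
  Vector_isFinHilbert.Build R (hext H) (hext_inner : {dot _ for idfun}).
End hext.

Definition proj_space (R : realType) (H : finHilbertType R) : Type :=
  {L : {vspace H} | \dim L == 1%N}.

Section proj_space.
Context {R : realType} {H : finHilbertType R}.

HB.instance Definition _ := Choice.on (proj_space H).

Let proj_subproof (x : H) : x != 0 -> \dim <[x]>%VS == 1%N.
Proof. by move=> x0; rewrite dim_vline x0. Qed.

Definition proj (x : H) (x0 : x != 0) : proj_space H :=
  exist _ <[x]>%VS (proj_subproof x0).

(* Well defined up to sign only; [proj_distE] is the formula for the distance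
   in terms of arbitrary representatives. *)
Definition unit_vec (L : proj_space H) : H :=
  `|vpick (sval L)|^-1 *: vpick (sval L).

Definition proj_dist (L M : proj_space H) : R :=
  Num.min `|unit_vec L - unit_vec M| `|unit_vec L + unit_vec M|.

Lemma unit_vec_proj (x : H) (x0 : x != 0) :
  unit_vec (proj x0) = `|x|^-1 *: x \/ unit_vec (proj x0) = - (`|x|^-1 *: x).
Proof.
rewrite /unit_vec /=; set v := vpick _.
have v0 : v != 0.
  by rewrite vpick0; apply: contraTneq (proj_subproof x0) => ->; rewrite dimv0.
have /vlineP[k vE] : v \in <[x]>%VS by exact: memv_pick.
rewrite vE normrZ invfM scalerA.
have k0 : k != 0 by apply: contraNneq v0 => k0; rewrite vE k0 scale0r.
have [kp|kn] := ltP 0 k; [left|right].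
  by rewrite gtr0_norm// mulrAC mulVf// mul1r.
rewrite ler0_norm// invrN !mulNr mulrAC mulVf// mul1r.
by rewrite scaleNr.
Qed.

Lemma proj_distE (x y : H) (x0 : x != 0) (y0 : y != 0) :
  proj_dist (proj x0) (proj y0) =
  Num.min `| `|x|^-1 *: x - `|y|^-1 *: y| `| `|x|^-1 *: x + `|y|^-1 *: y|.
Proof.
rewrite /proj_dist; have := unit_vec_proj y0; have := unit_vec_proj x0.
set a := _ *: x; set b := _ *: y => -[->|->] [->|->] //.
- by rewrite opprK minC.
- by rewrite -opprD normrN (addrC (- a)) (distrC b) minC.
- by rewrite opprK -opprD normrN (addrC (- a)) (distrC b).
Qed.

Let proj_dist_xx L : proj_dist L L = 0.
Proof.
by rewrite /proj_dist subrr normr0; apply/min_idPl; rewrite normr_ge0.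
Qed.

Let vpick_neq0 (L : proj_space H) : vpick (sval L) != 0.
Proof.
rewrite vpick0; case: L => L /= L1.
by apply: contraTneq L1 => ->; rewrite dimv0.
Qed.

Let span_unit_vec (L : proj_space H) : sval L = <[unit_vec L]>%VS.
Proof.
apply/esym/eqP; rewrite eqEdim -memvE memvZ ?memv_pick//=.
rewrite (eqP (svalP L)) dim_vline lt0b scaler_eq0 invr_eq0 normr_eq0.
by rewrite (negPf (vpick_neq0 L)).
Qed.

Let proj_dist_positivity L M : proj_dist L M = 0 -> L = M.
Proof.
rewrite /proj_dist => LM; apply/val_inj.
change (sval L = sval M); rewrite (span_unit_vec L) (span_unit_vec M).
have [/normr0_eq0/eqP|/normr0_eq0/eqP] : `|unit_vec L - unit_vec M| = 0 \/
    `|unit_vec L + unit_vec M| = 0.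
- by move: LM; rewrite /Order.min; case: ifP => _ LM; [left|right].
- by rewrite subr_eq0 => /eqP ->.
- rewrite addr_eq0 => /eqP ->; apply/eqP; rewrite eqEsubv -!memvE.
  by rewrite memvN memv_line -[X in X \in _]opprK memvN memv_line.
Qed.

Let proj_dist_sym L M : proj_dist L M = proj_dist M L.
Proof. by rewrite /proj_dist distrC (addrC (unit_vec L)). Qed.

Let proj_dist_triangle M L N : proj_dist L N <= proj_dist L M + proj_dist M N.
Proof.
rewrite /proj_dist; set u := unit_vec L; set v := unit_vec M.
set w := unit_vec N; rewrite ge_min.
have h1 := ler_normD (u - v) (v - w); have h2 := ler_normD (u - v) (v + w).
have h3 := ler_normD (u + v) (- (v + w)).
have h4 := ler_normD (u + v) (- (v - w)).
rewrite !normrN in h3 h4.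
have e1 : (u - v) + (v - w) = u - w by rewrite addrA subrK.
have e2 : (u - v) + (v + w) = u + w by rewrite addrA subrK.
have e3 : (u + v) - (v + w) = u - w by rewrite opprD addrA addrK.
have e4 : (u + v) - (v - w) = u + w by rewrite opprB addrA addrAC addrK.
rewrite e1 in h1; rewrite e2 in h2; rewrite e3 in h3; rewrite e4 in h4.
by apply/orP; rewrite {1 2 3 4}/Order.min; case: ifP; case: ifP; auto.
Qed.

HB.instance Definition _ := isMetric.Build R (proj_space H)
  proj_dist_xx proj_dist_positivity proj_dist_sym proj_dist_triangle.

(* The map induced by f on lines. The default value L of [insubd] is only taken
   if f vanishes on L. *)
Definition proj_map (f : H -> H) (L : proj_space H) : proj_space H :=
  insubd L <[f (vpick (sval L))]>%VS.

Lemma proj_map_proj (f : H -> H) (x : H) (x0 : x != 0) (fx0 : f x != 0) :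
  linear f -> proj_map f (proj x0) = proj fx0.
Proof.
move=> lf; apply/val_inj; rewrite /proj_map /=.
have fZ k : f (k *: x) = k *: f x.
  by have := lf k x 0; rewrite (_ : f 0 = 0) ?addr0//;
     have := lf (-1) 0 0; rewrite scaler0 addr0 scaleN1r addNr.
have /vlineP[k vE] : vpick <[x]>%VS \in <[x]>%VS by exact: memv_pick.
have k0 : k != 0.
  have := vpick_neq0 (proj x0); rewrite /= vE.
  by apply: contraNneq => ->; rewrite scale0r.
have kE : <[f (k *: x)]>%VS = <[f x]>%VS.
  apply/eqP; rewrite fZ eqEdim !dim_vline -memvE memvZ ?memv_line//=.
  by rewrite fx0 scaler_eq0 negb_or k0 fx0.
by rewrite val_insubd vE kE dim_vline fx0.
Qed.

End proj_space.

Section chains.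
Context {R : realType} {X : metricType R}.
Implicit Types (Phi : R -> X -> X) (Y : set X).

Definition is_flow Phi :=
  [/\ continuous (fun p : R * X => Phi p.1 p.2),
      Phi 0 = id
    & forall t s, Phi (t + s) = Phi t \o Phi s].

Definition chain Phi (eps T : R) (x y : X) :=
  exists n (T_ : nat -> R) (x_ : nat -> X),
    [/\ (0 < n)%N, x_ 0%N = x, x_ n = y
      & forall i, (i < n)%N ->
          T <= T_ i /\ mdist (Phi (T_ i) (x_ i)) (x_ i.+1) < eps].

Definition chain_recurrent Phi : set X :=
  [set x | forall eps T, 0 < eps -> 0 < T -> chain Phi eps T x x].

Definition chain_transitive Phi Y :=
  forall x y, Y x -> Y y ->
  forall eps T, 0 < eps -> 0 < T -> chain Phi eps T x y.

Definition chain_component Phi Y :=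
  chain_transitive Phi Y /\
  forall Z, chain_transitive Phi Z -> Y `<=` Z -> Z = Y.

End chains.

Definition skew_prod {B E : Type} {R : Type} (theta : R -> B -> B)
    (psi : R -> B -> E -> E) (t : R) (p : B * E) : B * E :=
  (theta t p.1, psi t p.1 p.2).

Section linear_flows.
Context {R : realType} {B : metricType R} {H : finHilbertType R}.
Implicit Types (theta : R -> B -> B) (phi : R -> B -> H -> H).

Definition linear_flow theta phi :=
  is_flow (skew_prod theta phi) /\ forall t b, linear (phi t b).

Definition proj_flow theta phi : R -> B * proj_space H -> B * proj_space H :=
  skew_prod theta (fun t b => proj_map (phi t b)).

Definition proj_set (V : set (B * H)) : set (B * proj_space H) :=
  [set q | exists (x : H) (x0 : x != 0), V (q.1, x) /\ q.2 = proj x0].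

Definition bundle_of (M : set (B * proj_space H)) : set (B * H) :=
  [set p | forall x0 : p.2 != 0, M (p.1, proj x0)].

(* That these sets are subbundles with B * H as their direct sum is Selgrade's
   theorem, not part of their definition. *)
Definition selgrade_bundle theta phi (V : set (B * H)) :=
  exists2 M, chain_component (proj_flow theta phi) M & V = bundle_of M.

End linear_flows.

Section affine_flows.
Context {R : realType} {B : metricType R} {H : finHilbertType R}.
Implicit Types (theta : R -> B -> B) (phi psi : R -> B -> H -> H).
Implicit Types (f : B -> R -> H) (g : R -> H).

(* Elements of L^oo(R, H) are represented by Borel functions; every notion
   below only depends on their classes modulo equality almost everywhere. *)
Definition Linfty g :=
  (forall U : set H, open U -> measurable (g @^-1` U)) /\
  exists C : R, {ae lebesgue_measure, forall t : R, `|g t| <= C}.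

(* Integration of coordinates; for integrable g the value does not depend on the
   basis. *)
Definition vintegral (D : set R) g : H :=
  \sum_(i < \dim {:H})
    (\int[lebesgue_measure]_(s in D) coord (vbasis {:H}) i (g s)) *:
      (vbasis {:H})`_i.

(* The integral from 0 to t, for t of either sign. *)
Definition ointegral (t : R) g : H :=
  if 0 <= t then vintegral `[0, t] g else - vintegral `[t, 0] g.

Definition affine_term theta phi f (t : R) (b : B) : H :=
  ointegral t (fun s => phi (t - s) (theta s b) (f b s)).

(* The "almost all t, s" of the shift identity is read as "for almost all s, for
   almost all t", which is implied by the reading with respect to the Lebesgue
   measure of the plane and does not depend on the representatives chosen for
   the uncountably many classes f (theta s b). *)
Definition affine_flow theta phi f psi :=
  [/\ linear_flow theta phi,
      forall b, Linfty (f b),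
      forall b, {ae lebesgue_measure, forall s : R,
        {ae lebesgue_measure, forall t : R, f b (t + s) = f (theta s b) t}},
      forall t b x, psi t b x = phi t b x + affine_term theta phi f t b
    & continuous (fun p : R * (B * H) => skew_prod theta psi p.1 p.2)].

Definition lift theta phi f (t : R) (b : B) (z : hext H) : hext H :=
  (phi t b z.1 + z.2 *: affine_term theta phi f t b, z.2).

Definition hext1 : set (hext H) := [set z | z.2 != 0].

Definition proj_hext1 : set (proj_space (hext H)) :=
  [set L | exists (z : hext H) (z0 : z != 0), hext1 z /\ L = proj z0].

Lemma pair1_neq0 (x : H) : ((x, 1) : hext H) != 0.
Proof. by apply/eqP => /(congr1 snd)/eqP; rewrite oner_eq0. Qed.

Definition h1 (p : B * H) : B * proj_space (hext H) :=
  (p.1, proj (pair1_neq0 p.2)).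

(* Definite description: V is the one Selgrade bundle of the lift that meets
   B x H x (R \ {0}). *)
Definition central_selgrade_bundle theta phi f : set (B * hext H) -> Prop :=
  unique (fun V => selgrade_bundle theta (lift theta phi f) V /\
                   V `&` (setT `*` hext1) !=set0).

End affine_flows.

(* Main.v *)
Require Import Defs.
From HB Require Import structures.
From mathcomp Require Import all_boot all_order all_algebra.
From mathcomp Require Import all_classical all_reals all_analysis.
From mathcomp Require Import measurable_realfun ring lra.
(* Restores the [proj] of Defs, which the library shadows. *)
Import Defs.
Set Implicit Arguments.
Unset Strict Implicit.
Unset Printing Implicit Defensive.
Import Order.TTheory GRing.Theory Num.Theory.
Import numFieldNormedType.Exports.
Local Open Scope classical_set_scope.
Local Open Scope ring_scope.

(* The map h1 is Lipschitz and semiconjugates Psi to the projectivized lift,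
   so it sends chain recurrent points to chain recurrent points; the chain
   class of such an image is a chain component whose bundle meets B x
   H^{1,1}, hence it is M_c. For the rest, let the height of a line P(x, r)
   be |r| / ||(x, r)||. On the set of lines of height >= a > 0 the inverse of
   h1 is Lipschitz. If M_c lies in B x P H^{1,1}, then, being compact, it is
   bounded away from height 0; the nodes of fine chains between points of M_c
   are then of height bounded below too, and such chains pull back to chains
   of Psi. If N_c is compact, then no point of M_c has a height in ]0, c[ for
   some c > 0; since the lift preserves r, a chain component with this gap
   cannot contain both lines of height >= c and lines of height 0. *)

(** The semigroup law of the lift has to be derived: it amounts to a cocycle identity for the affine
    term, and the shift identity of [f] is available only for almost every [s]. Continuity of [psi]
    removes the exceptional times. The identity is established for nonnegative times, so the chain
    arguments treat the projectivized lift as a semiflow. A single node of a fine chain need not lie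
    in the component. What survives a limit is that it can be reached from a point of the component
    and can return to it; limits of such nodes, with errors 1/(n+1) and times n+1, do lie in the
    component. Nodes are therefore carried along together with chains in both directions. Lines have
    no continuous choice of a unit vector. Estimates on projective space therefore compare a fixed
    unit vector of one line with the nearer of the two unit vectors of the other. *)

Section pairing.
Context {T U V W Z : topologicalType}.

Lemma continuous_pairing (g : T -> U) (h : T -> V) x :
  {for x, continuous g} -> {for x, continuous h} ->
  {for x, continuous (fun y => (g y, h y))}.
Proof. by move=> cg ch; exact: cvg_pair cg ch. Qed.

Lemma continuous_curried2 (F : U -> V -> W) (g : T -> U) (h : T -> V) x :
  continuous (fun p : U * V => F p.1 p.2) ->
  {for x, continuous g} -> {for x, continuous h} ->
  {for x, continuous (fun y => F (g y) (h y))}.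
Proof.
move=> cF cg ch.
exact: (@continuous_comp _ _ _ (fun y => (g y, h y)) (fun p => F p.1 p.2) x
  (continuous_pairing cg ch) (cF _)).
Qed.

Lemma continuous_curried3 (F : U -> V -> W -> Z)
    (g : T -> U) (h : T -> V) (k : T -> W) x :
  continuous (fun p : U * (V * W) => F p.1 p.2.1 p.2.2) ->
  {for x, continuous g} -> {for x, continuous h} -> {for x, continuous k} ->
  {for x, continuous (fun y => F (g y) (h y) (k y))}.
Proof.
move=> cF cg ch ck.
exact: (@continuous_comp _ _ _ (fun y => (g y, (h y, k y)))
  (fun p => F p.1 p.2.1 p.2.2) x
  (cvg_pair cg (cvg_pair ch ck)) (cF _)).
Qed.

End pairing.

(** * Finite-dimensional spaces and vector integrals *)

Section finite_dimension.
Context {R : realType} {H : finHilbertType R}.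
Local Notation n := (\dim {:H}).

Definition of_coords (v : 'rV[R]_n) : H :=
  \sum_(i < n) v ord0 i *: (vbasis {:H})`_i.

Definition coords (x : H) : 'rV[R]_n := \row_i coord (vbasis {:H}) i x.

Lemma coordsK : cancel coords of_coords.
Proof.
move=> x; rewrite [RHS](coord_vbasis (memvf x)).
by apply: eq_bigr => i _; rewrite mxE.
Qed.

Lemma of_coords_continuous : continuous of_coords.
Proof.
apply: continuous_big => [|i _ v]; first exact: add_continuous.
exact: cvgZr_tmp (@coord_continuous R _ _ ord0 i v).
Qed.

Lemma of_coordsZ a v : of_coords (a *: v) = a *: of_coords v.
Proof.
rewrite /of_coords scaler_sumr; apply: eq_bigr => i _.
by rewrite mxE scalerA.
Qed.

Lemma of_coords_inj v : of_coords v = 0 -> v = 0.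
Proof.
move=> v0; apply/rowP => i; rewrite mxE.
have := coord_sum_free (fun j => v ord0 j) i (basis_free (vbasisP {:H})).
by rewrite -/(of_coords v) v0 linear0.
Qed.

(** The norm of [of_coords] has a positive minimum on the compact unit sphere of coordinate space,
    by injectivity; its inverse is the constant, by homogeneity. *)
Lemma coords_bounded :
  exists2 C : R, 0 < C & forall x : H, `|coords x| <= C * `|x|.
Proof.
pose S := [set v : 'rV[R]_n | `|v| = 1].
(* The sphere is empty when [H] is zero; then all coordinate vectors vanish. *)
have [S0|S0] := pselect (S !=set0); last first.
  exists 1 => // x; have [->|v0] := eqVneq (coords x) 0.
    by rewrite normr0 mul1r.
  exfalso; apply: S0; exists (`|coords x|^-1 *: coords x).
  by rewrite /S/= normrZ normfV normr_id mulVf// normr_eq0.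
have cS : compact S.
  apply: bounded_closed_compact.
    by exists 1; split => // r r1 v /= ->; exact: ltW.
  apply: (@preimage_closed _ _ (fun v : 'rV[R]_n => `|v|) [set 1]) => //.
  by move=> v _; apply: norm_continuous.
have cN : continuous (fun v => `|of_coords v|).
  by move=> v; exact: cvg_norm (@of_coords_continuous v).
have [v /set_mem Sv vmin] := compact_EVT_min S0 cS (continuous_subspaceT cN).
have m0 : 0 < `|of_coords v|.
  rewrite normr_gt0; apply/eqP => /of_coords_inj v0.
  by move: Sv; rewrite /S/= v0 normr0 => /esym/eqP; rewrite oner_eq0.
exists (`|of_coords v|^-1); first by rewrite invr_gt0.
move=> x; have [->|x0] := eqVneq (coords x) 0.
  by rewrite normr0 mulr_ge0// invr_ge0.
have nx0 : 0 < `|coords x| by rewrite normr_gt0.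
have := vmin (`|coords x|^-1 *: coords x).
rewrite inE /S/= normrZ normfV normr_id mulVf ?gt_eqF// => /(_ erefl).
rewrite of_coordsZ coordsK normrZ normfV normr_id => h.
by move: h; rewrite !ler_pdivlMl// mulrC.
Qed.

(** The ball is the continuous image of a closed set of coordinate vectors, which [coords_bounded]
    makes bounded. It yields the compactness of projective space. *)
Lemma closed_ball0_compact (r : R) : compact [set x : H | `|x| <= r].
Proof.
have -> : [set x : H | `|x| <= r] = of_coords @` [set v | `|of_coords v| <= r].
  apply/seteqP; split => [x /= xr|_ [v vr <-]//].
  by exists (coords x); rewrite /= ?coordsK.
apply: continuous_compact.
  exact/continuous_subspaceT/of_coords_continuous.
have [C C0 HC] := coords_bounded.
apply: bounded_closed_compact.
  exists (C * r); split => [|s Cs v /= vr]; first exact: num_real.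
  apply: le_trans (ltW Cs).
  have -> : v = coords (of_coords v).
    apply/rowP => i; rewrite mxE coord_sum_free//.
    exact: basis_free (vbasisP _).
  by rewrite (le_trans (HC _))// ler_wpM2l// ltW.
apply: (@preimage_closed _ _ (fun v => `|of_coords v|) [set x | x <= r]);
  last exact: closed_le.
by move=> v _; exact: cvg_norm (@of_coords_continuous v).
Qed.

Lemma coord_bounded : exists2 C : R, 0 < C &
  forall i (x : H), `|coord (vbasis {:H}) i x| <= C * `|x|.
Proof.
have [C C0 HC] := coords_bounded; exists C => // i x.
apply: le_trans (HC x).
have -> : coord (vbasis {:H}) i x = coords x ord0 i by rewrite mxE.
rewrite [leRHS]/Num.norm /= mx_normrE.
by apply/bigmax_geP; right => /=; exists (ord0, i).
Qed.

Lemma coord_vbasis_continuous i : continuous (coord (vbasis {:H}) i : H -> R).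
Proof.
have [C C0 HC] := coord_bounded.
move=> x; apply/cvgrPdist_lt => e e0; near=> y.
rewrite -raddfB (le_lt_trans (HC _ _))// -ltr_pdivlMl//.
near: y; apply: cvgr_dist_lt; first exact: cvg_id.
by rewrite mulr_gt0// invr_gt0.
Unshelve. all: by end_near. Qed.

End finite_dimension.

(** * Translation invariance of the Lebesgue integral *)

Section integral_shift.
Context {R : realType}.
Local Notation mu := (@lebesgue_measure R).

Lemma shift_preimage_itv (s a b : R) (x y : bool) :
  (fun u => u + s) @^-1` [set` Interval (BSide x a) (BSide y b)] =
  [set` Interval (BSide x (a - s)) (BSide y (b - s))].
Proof.
by apply/seteqP; split => u /=; rewrite !in_itv/=;
  case: x; case: y; rewrite /= !(lerBlDr, ltrBlDr, lerBrDr, ltrBrDr).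
Qed.

Lemma measurable_shift (s : R) :
  measurable_fun [set: measurableTypeR R] (fun u => u + s : measurableTypeR R).
Proof. exact: measurable_funD. Qed.

Let shift_mfun (s : R) : {mfun measurableTypeR R >-> measurableTypeR R} :=
  HB.pack (fun u : measurableTypeR R => u + s : measurableTypeR R)
    (isMeasurableFun.Build _ _ _ _ _ (measurable_shift s)).

Lemma lebesgue_measure_shift (s : R) (A : set R) : measurable A ->
  pushforward mu (fun u => u + s : measurableTypeR R) A = mu A.
Proof.
move=> mA; apply/esym/lebesgue_measure_unique => //.
  exact: measurable_shift.
move=> _ _ [[a b]] _ <- /=.
rewrite /pushforward shift_preimage_itv !lebesgue_measure_itv/=.
rewrite !lte_fin ltrD2r; case: ifP => // _.
by rewrite -!EFinB; congr EFin; ring.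
Qed.

Lemma Rintegral_shift (s : R) (D : set R) (f : R -> R) :
  measurable D -> measurable_fun [set: R] f ->
  mu.-integrable ((fun u => u + s) @^-1` D) (EFin \o (fun u => f (u + s))) ->
  \int[mu]_(u in D) f u = \int[mu]_(u in (fun u => u + s) @^-1` D) f (u + s).
Proof.
move=> mD mf intf; rewrite /Rintegral; congr fine.
rewrite -(@integral_pushforward _ _ _ _ _ _ (measurable_shift s) mu D
  (EFin \o f))//=; last exact/measurable_EFinP.
apply: eq_measure_integral => [|ms A mA _]; first exact: measurable_shift.
exact/esym/lebesgue_measure_shift.
Qed.

End integral_shift.

Section vector_integral.
Context {R : realType} {H : finHilbertType R}.
Local Notation mu := (@lebesgue_measure R).
Local Notation e := (vbasis {:H}).
Implicit Types (D : set R) (g : R -> H).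

Definition coord_measurable g :=
  forall i, measurable_fun [set: R] (fun s => coord e i (g s)).

Definition coord_integrable D g :=
  forall i, mu.-integrable D (EFin \o (fun s => coord e i (g s))).

Lemma Rintegral_sum (I : Type) (r : seq I) D (F : I -> R -> R) :
  measurable D -> (forall i, mu.-integrable D (EFin \o F i)) ->
  \int[mu]_(s in D) (\sum_(i <- r) F i s) =
  \sum_(i <- r) \int[mu]_(s in D) F i s.
Proof.
move=> mD intF; elim: r => [|i r IH].
  rewrite big_nil; under eq_Rintegral do rewrite big_nil.
  by rewrite Rintegral_cst// mul0r.
rewrite big_cons -IH -RintegralD//.
  by apply: eq_Rintegral => s _; rewrite big_cons.
rewrite (_ : _ \o _ = fun s => (\sum_(j <- r) (F j s)%:E)%E); last first.
  by apply/funext => s /=; rewrite sumEFin.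
by apply: integrable_sum => // j _; exact: intF.
Qed.

(** The matrix of [A] reduces statements about vector integrands to finite sums of products of
    scalar functions. *)
Lemma coord_comp (A : {linear H -> H}) i x :
  coord e i (A x) = \sum_(j < \dim {:H}) coord e i (A e`_j) * coord e j x.
Proof.
rewrite {1}(coord_vbasis (memvf x)) !linear_sum/=.
by apply: eq_bigr => j _; rewrite !linearZ mulrC.
Qed.

Lemma vintegral_linear (A : {linear H -> H}) D g : measurable D ->
  coord_integrable D g -> vintegral D (A \o g) = A (vintegral D g).
Proof.
move=> mD intg; rewrite /vintegral linear_sum/=.
have E i : \int[mu]_(s in D) coord e i (A (g s)) =
    \sum_(j < \dim {:H}) coord e i (A e`_j) * \int[mu]_(s in D) coord e j (g s).
  under eq_Rintegral do rewrite coord_comp.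
  rewrite Rintegral_sum//.
    by apply: eq_bigr => j _; rewrite RintegralZl//; exact: intg.
  move=> j; rewrite (_ : _ \o _ = fun s =>
    ((coord e i (A e`_j))%:E * (coord e j (g s))%:E)%E)//.
  by apply: integrableZl => //; exact: intg.
under eq_bigr do rewrite E scaler_suml.
rewrite exchange_big; apply: eq_bigr => j _ /=.
rewrite linearZ/= [in RHS](coord_vbasis (memvf (A e`_j))) scaler_sumr.
by apply: eq_bigr => i _; rewrite scalerA mulrC.
Qed.

Lemma eq_vintegral D g g' : {in D, g =1 g'} -> vintegral D g = vintegral D g'.
Proof.
move=> gg'; apply: eq_bigr => i _; congr (_ *: _).
by apply: eq_Rintegral => s Ds; rewrite gg'.
Qed.

Lemma ae_eq_vintegral D g g' : measurable D ->
  coord_measurable g -> coord_measurable g' ->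
  {ae mu, forall s, g s = g' s} -> vintegral D g = vintegral D g'.
Proof.
move=> mD mg mg' gg'; apply: eq_bigr => i _; congr (_ *: _).
rewrite /Rintegral; congr fine; apply: ae_eq_integral => //.
- by apply/measurable_EFinP; apply: measurable_funTS; exact: mg.
- by apply/measurable_EFinP; apply: measurable_funTS; exact: mg'.
- by apply: (@filterS _ _ (ae_filter_ringOfSetsType mu)) gg' => s -> .
Qed.

Lemma vintegral_shift (s : R) D g : measurable D ->
  coord_measurable g ->
  coord_integrable ((fun u => u + s) @^-1` D) (fun u => g (u + s)) ->
  vintegral D g = vintegral ((fun u => u + s) @^-1` D) (fun u => g (u + s)).
Proof.
move=> mD mg ig; apply: eq_bigr => i _; congr (_ *: _).
by rewrite (@Rintegral_shift _ s).
Qed.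

Lemma vintegral_setU D D' g : measurable D -> measurable D' ->
  coord_integrable (D `|` D') g -> [disjoint D & D'] ->
  vintegral (D `|` D') g = vintegral D g + vintegral D' g.
Proof.
move=> mD mD' ig dD; rewrite /vintegral -big_split/=; apply: eq_bigr => i _.
by rewrite Rintegral_setU// -?scalerDl//; exact: ig.
Qed.

Lemma vintegral_itv_obnd_cbnd (a : R) (b : itv_bound R) g :
  coord_integrable [set` Interval (BRight a) b] g ->
  vintegral [set` Interval (BRight a) b] g =
  vintegral [set` Interval (BLeft a) b] g.
Proof.
move=> ig; apply: eq_bigr => i _; congr (_ *: _).
by rewrite Rintegral_itv_obnd_cbnd//; exact: ig.
Qed.

End vector_integral.

(** * Integrands given by a path of linear maps applied to an essentially bounded function *)

Section linear_paths.
Context {R : realType} {H : finHilbertType R}.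
Local Notation mu := (@lebesgue_measure R).
Local Notation e := (vbasis {:H}).

Definition packed_linear (A : H -> H) (lA : linear A) : {linear H -> H} :=
  HB.pack A (GRing.isLinear.Build R H H *:%R A lA).

Lemma Linfty_coord_measurable (g : R -> H) : Linfty g -> coord_measurable g.
Proof.
move=> [mg _] i; apply: (measurability _ (RGenOpens.measurableE R)) => //.
move=> _ [_ [x [y ->]] <-]; rewrite setTI.
apply: (mg (coord e i @^-1` `]x, y[%classic)).
move/continuousP : (@coord_vbasis_continuous _ H i); apply.
exact: interval_open.
Qed.

(** Stands for the propagator [phi (t - u) (theta u b)] as a function of [u]. Continuity at each
    fixed vector suffices, since the matrix entries involve finitely many basis vectors. *)
Variable L : R -> H -> H.
Hypothesis linL : forall u, linear (L u).
Hypothesis cL : forall x, continuous (L ^~ x).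

Let coordLE i (g : R -> H) : (fun u => coord e i (L u (g u))) =
  (fun u => \sum_(j < \dim {:H}) coord e i (L u e`_j) * coord e j (g u)).
Proof. by apply/funext => u; exact: (coord_comp (packed_linear (linL u))). Qed.

Let continuous_coordL i x : continuous (fun u => coord e i (L u x)).
Proof.
by move=> u; apply: continuous_comp; [exact: cL|exact: coord_vbasis_continuous].
Qed.

Lemma linear_path_measurable g :
  coord_measurable g -> coord_measurable (fun u => L u (g u)).
Proof.
move=> mg i; rewrite coordLE; apply: measurable_sum => j.
by apply: measurable_funM; [exact: continuous_measurable_fun|exact: mg].
Qed.

(** On a segment the matrix entries of [L u] are continuous, hence bounded, and the coordinates of
    [g] are essentially bounded, hence integrable. *)
Lemma linear_path_integrable g (C a b : R) : coord_measurable g ->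
  {ae mu, forall u, `|g u| <= C} ->
  coord_integrable `[a, b] (fun u => L u (g u)).
Proof.
move=> mg gC i; rewrite coordLE.
rewrite (_ : _ \o _ = fun u => (\sum_(j < \dim {:H})
    ((EFin \o (fun u => coord e i (L u e`_j))) \*
     (EFin \o (fun u => coord e j (g u)))) u)%E); last first.
  by apply/funext => s /=; rewrite sumEFin.
apply: integrable_sum => // j _.
have [K K0 HK] := @coord_bounded _ H.
apply: integrableMr => //.
- by apply: measurable_funTS; exact: continuous_measurable_fun.
- have : compact ((fun u => coord e i (L u e`_j)) @` `[a, b]).
    apply: continuous_compact; last exact: segment_compact.
    exact: continuous_subspaceT.
  move=> /compact_bounded[M [Mreal HM]]; exists M; split => // M' /HM HM' u Du.
  by apply: HM'; exists u.
apply/integrableP; split.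
  by apply/measurable_EFinP; apply: measurable_funTS; exact: mg.
(* The absolute value makes the bound nonnegative, as [C] carries no sign. *)
apply: le_lt_trans (integral_le_bound (`|K * C|%:E) _ _ _ _) _ => //.
- by apply/measurable_EFinP; apply: measurable_funTS; exact: mg.
- apply: (@filterS _ _ (ae_filter_ringOfSetsType mu)) gC => u gu _ /=.
  rewrite lee_fin (le_trans (HK _ _))// (le_trans _ (ler_norm _))//.
  by rewrite ler_wpM2l// ltW.
- rewrite lte_mul_pinfty//= lebesgue_measure_itv/=.
  by case: ifP => // _; rewrite -EFinB ltry.
Qed.

End linear_paths.

(** * The cocycle identity of the affine term *)

Section affine_cocycle.
Context {R : realType} {B : metricType R} {H : finHilbertType R}.
Local Notation mu := (@lebesgue_measure R).
Variables (theta : R -> B -> B) (phi psi : R -> B -> H -> H) (f : B -> R -> H).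
Hypothesis thetaF : is_flow theta.
Hypothesis aff : affine_flow theta phi f psi.

Let thetaD t s b : theta (t + s) b = theta t (theta s b).
Proof. by case: thetaF => _ _ ->. Qed.

Let phiD t s b x : phi (t + s) b x = phi t (theta s b) (phi s b x).
Proof.
case: aff => [[[_ _ h] _] _ _ _ _].
exact: (congr1 (fun F => (F (b, x)).2) (h t s)).
Qed.

Let lin_phi t b : linear (phi t b).
Proof. by case: aff => [[]]. Qed.

Lemma phi_continuous : continuous (fun p : R * (B * H) => phi p.1 p.2.1 p.2.2).
Proof.
case: aff => [[[c _ _] _] _ _ _ _] p.
exact: (continuous_comp (c p) cvg_snd).
Qed.

Lemma psi_continuous : continuous (fun p : R * (B * H) => psi p.1 p.2.1 p.2.2).
Proof. by case: aff => _ _ _ _ c p; exact: (continuous_comp (c p) cvg_snd). Qed.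

Lemma phi0r t b : phi t b 0 = 0.
Proof. exact: (linear0 (packed_linear (lin_phi t b))). Qed.

(** Through this identity the affine term inherits its joint continuity from [psi], with no estimate
    on the integral. *)
Lemma affine_termE t b : affine_term theta phi f t b = psi t b 0.
Proof. by case: aff => _ _ _ -> _; rewrite phi0r add0r. Qed.

Lemma affine_term_continuous :
  continuous (fun p : R * B => affine_term theta phi f p.1 p.2).
Proof.
rewrite (_ : (fun p => _) = fun p => psi p.1 p.2 0); last first.
  by apply/funext => p; rewrite affine_termE.
move=> p; apply: (continuous_curried3 psi_continuous); first exact: cvg_fst.
  exact: cvg_snd.
exact: cvg_cst.
Qed.

Let theta_path b : continuous (theta ^~ b).
Proof.
case: thetaF => c _ _ u; apply: (continuous_curried2 c); first exact: cvg_id.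
exact: cvg_cst.
Qed.

Let phi_path t b x : continuous (fun u => phi (t - u) (theta u b) x).
Proof.
move=> u; apply: (continuous_curried3 phi_continuous).
- by apply: cvgB; [exact: cvg_cst|exact: cvg_id].
- exact: theta_path.
- exact: cvg_cst.
Qed.

(** The integral over [0, t + s] is split at [s]. On the first piece the propagator factors through
    [phi t (theta s b)], which leaves the integral; on the second, translation by [s] and the shift
    identity give the affine term at [theta s b]. *)
Lemma affine_term_cocycle_ae t s b : 0 <= t -> 0 <= s ->
  {ae mu, forall u, f b (u + s) = f (theta s b) u} ->
  affine_term theta phi f (t + s) b =
  phi t (theta s b) (affine_term theta phi f s b) +
  affine_term theta phi f t (theta s b).
Proof.
move=> t0 s0 fs; rewrite /affine_term /ointegral addr_ge0// t0 s0.
case: aff => _ Lf _ _ _.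
set G := fun u => phi (t + s - u) (theta u b) (f b u).
have fM c := Linfty_coord_measurable (Lf c).
have mG : coord_measurable G.
  exact: (linear_path_measurable (fun u => @lin_phi (t + s - u) (theta u b))
    (@phi_path _ _)).
have iG x y : coord_integrable `[x, y] G.
  have [_ [C fC]] := Lf b.
  exact: (linear_path_integrable (fun u => @lin_phi (t + s - u) (theta u b))
    (@phi_path _ _) _ _ (fM b) fC).
have itvU : `[0, t + s]%classic =
    `[0, s]%classic `|` `]s, t + s]%classic :> set R.
  by rewrite -itv_bndbnd_setU// bnd_simp// lerDr.
rewrite itvU vintegral_setU//; last 2 first.
- by rewrite -itvU.
- apply/disj_setPS => u /= []; rewrite !in_itv/= => /andP[_ us] /andP[su _].
  by rewrite ltNge us in su.
congr (_ + _).
  transitivity (vintegral `[0, s] (phi t (theta s b) \o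
      (fun u => phi (s - u) (theta u b) (f b u)))).
    apply: eq_vintegral => u _ /=; rewrite /G -addrA phiD; congr (phi t _ _).
    by rewrite -thetaD subrK.
  apply: (vintegral_linear (packed_linear (lin_phi t (theta s b)))) => //.
  have [_ [C fC]] := Lf b.
  exact: (linear_path_integrable (fun u => @lin_phi (s - u) (theta u b))
    (@phi_path _ _) _ _ (fM b) fC).
have E : (fun u => u + s) @^-1` `]s, t + s]%classic = `]0, t]%classic.
  by rewrite shift_preimage_itv subrr addrK.
have GE u : G (u + s) = phi (t - u) (theta u (theta s b)) (f b (u + s)).
  by rewrite /G -thetaD; congr (phi _ _ _); ring.
have mfs : coord_measurable (fun u => f b (u + s)).
  by move=> i; apply: (measurableT_comp (fM b i)); exact: measurable_shift.
have iGs : coord_integrable `[0, t] (fun u => G (u + s)).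
  rewrite (_ : (fun u => G (u + s)) =
    fun u => phi (t - u) (theta u (theta s b)) (f b (u + s)));
    last exact/funext.
  (* The bound is that of [f (theta s b)], with which the shifted [f b] agrees almost everywhere. *)
  have [_ [C fC]] := Lf (theta s b).
  apply: (@linear_path_integrable _ _
    (fun u => phi (t - u) (theta u (theta s b))) _ _ _ C) => //.
  by apply: (@filterS2 _ _ (ae_filter_ringOfSetsType mu)) fs fC => u ->.
have iGs' : coord_integrable `]0, t] (fun u => G (u + s)).
  by move=> i; apply: integrableS (iGs i) => //; exact: subset_itv_oc_cc.
rewrite (vintegral_shift (s := s))//; last by rewrite E.
rewrite E vintegral_itv_obnd_cbnd//.
apply: ae_eq_vintegral => //.
- by move=> i; apply: (measurableT_comp (mG i)); exact: measurable_shift.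
- exact: (linear_path_measurable
    (fun u => @lin_phi (t - u) (theta u (theta s b))) (@phi_path _ _)).
- apply: (@filterS _ _ (ae_filter_ringOfSetsType mu)) fs => u fu.
  by rewrite GE fu.
Qed.

(* By continuity, since the almost every s of the previous lemma are dense. *)
Lemma affine_term_cocycle t s b : 0 <= t -> 0 <= s ->
  affine_term theta phi f (t + s) b =
  phi t (theta s b) (affine_term theta phi f s b) +
  affine_term theta phi f t (theta s b).
Proof.
move=> t0 s0; pose a := affine_term theta phi f.
pose d u := a (t + u) b - (phi t (theta u b) (a u b) + a t (theta u b)).
have ca (g : R -> R) (h : R -> B) u : {for u, continuous g} ->
    {for u, continuous h} -> {for u, continuous (fun u => a (g u) (h u))}.
  exact: continuous_curried2 affine_term_continuous.
have cd : continuous d.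
  move=> u; apply: cvgB.
    apply: ca; last exact: cvg_cst.
    by apply: cvgD; [exact: cvg_cst|exact: cvg_id].
  apply: cvgD.
    apply: (continuous_curried3 phi_continuous); first exact: cvg_cst.
      exact: theta_path.
    by apply: ca; [exact: cvg_id|exact: cvg_cst].
  by apply: ca; [exact: cvg_cst|exact: theta_path].
apply/eqP; rewrite -subr_eq0 -/(d s); apply/negPn/negP => ds0.
have /nbhs_ballP[r /= r0 rd] : \forall u \near s, d u != 0.
  exact: cvgr_neq0 (@cd s) ds0.
have [_ _ /(_ b) [N [mN N0 subN]] _ _] := aff.
(* Points of the interval are nonnegative since [s] is, so the defect [d] vanishes wherever the
   shift identity holds. As [d] is nonzero on the whole interval, the interval lies in the null set
   [N], against its length [r]. *)
have : mu `]s, s + r[ = 0%E.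
  apply: (subset_measure0 _ _ _ N0) => //.
  move=> u /=; rewrite in_itv/= => /andP[su ur].
  apply: subN => /= fu.
  have : d u != 0 by apply: rd; rewrite /ball/= ltr_norml; lra.
  rewrite /d /a affine_term_cocycle_ae ?subrr ?eqxx//.
  exact: ltW (le_lt_trans s0 su).
rewrite lebesgue_measure_itv/= lte_fin ltrDl r0 -EFinB => -[] /eqP.
by rewrite addrAC subrr add0r gt_eqF.
Qed.

End affine_cocycle.

(** * Chains and their limits *)

Section ultrafilters.

Lemma fmap_ultra (I T : Type) (U : set_system I) (f : I -> T) :
  UltraFilter U -> UltraFilter (f @ U).
Proof.
move=> UU; split; first exact: fmap_proper_filter.
move=> G GF UG; rewrite predeqE => A; split; last exact: UG.
move=> GA; have [//|UnA] := in_ultra_setVsetC (f @^-1` A) UU.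
have : G (~` A) by exact: UG.
by move=> /(filterI GA); rewrite setICr => /filter_not_empty.
Qed.

(** Replaces the extraction of subsequences: along one ultrafilter finer than [\oo] all sequences in
    compact sets converge at once. *)
Lemma compact_ultra_cvg (I : Type) (T : topologicalType) (A : set T)
    (U : set_system I) (f : I -> T) :
  UltraFilter U -> compact A -> (\forall i \near U, A (f i)) ->
  exists2 x, A x & f @ U --> x.
Proof.
move=> UU; rewrite compact_ultra => cA UA.
have := fmap_ultra f UU.
by move=> /cA/(_ UA)[x [Ax fx]]; exists x.
Qed.

(** An ultrafilter excludes oscillation: nonnegative times either stay in a segment, and then
    converge, or tend to infinity. *)
Lemma ultra_bounded_or_cvgy (I : Type) (R : realType) (U : set_system I)
    (f : I -> R) : UltraFilter U ->
  (exists S, \forall i \near U, f i <= S) \/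
  (forall S, \forall i \near U, S <= f i).
Proof.
move=> UU; have [h|h] := pselect (exists S, \forall i \near U, f i <= S).
  by left.
right => S; have [Uf|] := in_ultra_setVsetC [set i | f i <= S] UU.
  by exfalso; apply: h; exists S.
by apply: filterS => i /= /negP; rewrite -ltNge => /ltW.
Qed.

Lemma eventually_small_large (R : realType) (e T : R) : 0 < e ->
  \forall n \near \oo, n.+1%:R^-1 <= e /\ T <= n.+1%:R.
Proof.
move=> e0; have T0 : 0 < Num.max T 1 by rewrite lt_max ltr01 orbT.
have T1 : 0 < (Num.max T 1)^-1 by rewrite invr_gt0.
near=> n; split.
  by rewrite ltW//; near: n; exact: (near_infty_natSinv_lt (PosNum e0)).
have : n.+1%:R^-1 < (Num.max T 1)^-1.
  by near: n; exact: (near_infty_natSinv_lt (PosNum T1)).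
by rewrite ltf_pV2 ?posrE// gt_max => /andP[/ltW].
Unshelve. all: by end_near. Qed.

End ultrafilters.

Section chains.
Context {R : realType} {X : metricType R}.
Variable Phi : R -> X -> X.
Implicit Types (x y z : X) (eps T t s : R).

Lemma chain_step eps T t x y :
  T <= t -> mdist (Phi t x) y < eps -> chain Phi eps T x y.
Proof.
by move=> Tt xy; exists 1, (fun=> t), (fun i => if i is 0 then x else y);
  split => // -[].
Qed.

Lemma chain_cons eps T t x y z :
  T <= t -> mdist (Phi t x) y < eps -> chain Phi eps T y z ->
  chain Phi eps T x z.
Proof.
move=> Tt xy [n [T_ [x_ [n0 x0 xn h]]]].
exists n.+1, (fun i => if i is j.+1 then T_ j else t),
  (fun i => if i is j.+1 then x_ j else x); split => // -[|i] /=.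
  by rewrite x0.
by rewrite ltnS; exact: h.
Qed.

(** Induction on the first jump. The step also supplies the remaining chain to [y], needed for
    properties of nodes that can return. *)
Lemma chain_elim eps T y (P : X -> Prop) :
  (forall x t, T <= t -> mdist (Phi t x) y < eps -> P x) ->
  (forall x t z, T <= t -> mdist (Phi t x) z < eps -> chain Phi eps T z y ->
    P z -> P x) ->
  forall x, chain Phi eps T x y -> P x.
Proof.
move=> Pstep Pcons x [n [T_ [x_ [+ + + +]]]].
elim: n T_ x_ x => [//|n IH] T_ x_ x _ x0 xn h.
have [Tt xx1] := h 0%N isT; rewrite x0 in xx1.
have [n0|n0] := posnP n.
  by apply: Pstep Tt _; rewrite n0 in xn; rewrite -xn.
have h' i : (i < n)%N -> T <= T_ i.+1 /\
    mdist (Phi (T_ i.+1) (x_ i.+1)) (x_ i.+2) < eps.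
  by move=> ni; exact: h.
apply: Pcons Tt xx1 _ _; last exact: (IH (T_ \o succn) (x_ \o succn)).
by exists n, (T_ \o succn), (x_ \o succn).
Qed.

Lemma chain_trans eps T x y z :
  chain Phi eps T x y -> chain Phi eps T y z -> chain Phi eps T x z.
Proof.
move=> xy yz; elim/chain_elim: x / xy => [x t Tt xy|x t w Tt xw _].
  exact: chain_cons Tt xy yz.
exact: chain_cons Tt xw.
Qed.

Lemma chain_weaken eps eps' T T' x y : eps <= eps' -> T' <= T ->
  chain Phi eps T x y -> chain Phi eps' T' x y.
Proof.
move=> ee TT xy; elim/chain_elim: x / xy => [x t Tt xy|x t w Tt xw _].
  exact: chain_step (le_trans TT Tt) (lt_le_trans xy ee).
exact: chain_cons (le_trans TT Tt) (lt_le_trans xw ee).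
Qed.

Lemma chain_perturb_end eps d T x y z : mdist y z < d ->
  chain Phi eps T x y -> chain Phi (eps + d) T x z.
Proof.
move=> yz xy; have d0 : 0 < d by exact: le_lt_trans (mdist_ge0 _ _) yz.
elim/chain_elim: x / xy => [x t Tt xy|x t w Tt xw _].
  apply: (chain_step Tt).
  by rewrite (le_lt_trans (metric_triangle _ y _))// ltrD.
by apply: (chain_cons Tt); rewrite (lt_le_trans xw)// lerDl ltW.
Qed.

(** Takes the first jump that leaves [P]. A chain has at least one jump, so the cases where this
    jump starts at [x] or ends at [y] are listed separately. *)
Lemma chain_crossing eps T x y (P : X -> Prop) :
  chain Phi eps T x y -> P x -> ~ P y ->
  exists x' w t, [/\ T <= t, mdist (Phi t x') w < eps, P x' /\ ~ P w,
    x' = x \/ chain Phi eps T x x' & w = y \/ chain Phi eps T w y].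
Proof.
move=> xy + nPy; elim/chain_elim: x / xy => [x t Tt xy Px|x t z Tt xz zy IH Px].
  by exists x, y, t; split => //; left.
have [Pz|nPz] := pselect (P z); last first.
  by exists x, z, t; split => //; [left|right].
have [x' [w [t' [Tt' x'w PP xx' wy]]]] := IH Pz.
exists x', w, t'; split => //; right; case: xx' => [->|].
  exact: chain_step Tt xz.
exact: chain_cons Tt xz.
Qed.

Definition reaches x y := forall eps T, 0 < eps -> 0 < T -> chain Phi eps T x y.

Lemma reaches_trans y x z : reaches x y -> reaches y z -> reaches x z.
Proof.
by move=> xy yz e T e0 T0; exact: chain_trans (xy _ _ e0 T0) (yz _ _ e0 T0).
Qed.

(** Nonempty exactly when [x] is chain recurrent; a chain component is the class of each of its
    points. *)
Definition chain_class x : set X := [set y | reaches x y /\ reaches y x].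

Lemma chain_class_component x :
  chain_recurrent Phi x -> chain_component Phi (chain_class x).
Proof.
move=> xx; split.
  by move=> y z [_ yx] [xz _]; exact: reaches_trans yx xz.
move=> Z tZ xZ; apply/seteqP; split=> // y Zy.
by have Zx : Z x by [exact: xZ]; split; exact: tZ.
Qed.

Lemma component_chain_class M x :
  chain_component Phi M -> M x -> M = chain_class x.
Proof.
move=> [tM maxM] Mx; apply/esym/maxM; last by move=> y My; split; exact: tM.
by move=> y z [_ yx] [xz _]; exact: reaches_trans yx xz.
Qed.

Hypothesis cPhi : continuous (fun p : R * X => Phi p.1 p.2).
Hypothesis PhiD : forall t s, 0 <= t -> 0 <= s -> Phi (t + s) = Phi t \o Phi s.

Lemma flow_continuous t : continuous (Phi t).
Proof.
by move=> x; apply: (continuous_curried2 cPhi); [exact: cvg_cst|exact: cvg_id].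
Qed.

Lemma flow_cvg (I : Type) (F : set_system I) (t_ : I -> R) (x_ : I -> X) t x :
  Filter F -> t_ @ F --> t -> x_ @ F --> x ->
  (fun i => Phi (t_ i) (x_ i)) @ F --> Phi t x.
Proof.
move=> FF tt xx.
exact: (continuous2_cvg _ (@cPhi (t, x)) tt xx).
Qed.

Lemma reaches_limit (I : Type) (F : set_system I) (z_ : I -> X) x z :
  ProperFilter F -> z_ @ F --> z ->
  (forall eps T, 0 < eps -> 0 < T ->
    \forall i \near F, chain Phi eps T x (z_ i)) ->
  reaches x z.
Proof.
move=> FF zz xz eps T e0 T0.
have e2 : 0 < eps / 2 by rewrite divr_gt0.
have zd : \forall i \near F, mdist z (z_ i) < eps / 2.
  exact: metricType_numDomainType.cvgr_dist_lt.
have [i [/= xzi zzi]] :=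
  @filter_ex _ F _ _ (@filterI _ F _ _ _ (xz _ _ e2 T0) zd).
rewrite (splitr eps); apply: chain_perturb_end xzi.
by rewrite metric_sym.
Qed.

(* The jump from the limit is made at time T, after which the orbit of z_i is
   followed; this needs chains from z_i with jump times at least 2T. *)
Lemma limit_reaches (I : Type) (F : set_system I) (z_ : I -> X) z y :
  ProperFilter F -> z_ @ F --> z ->
  (forall eps T, 0 < eps -> 0 < T ->
    \forall i \near F, chain Phi eps T (z_ i) y) ->
  reaches z y.
Proof.
move=> FF zz zy eps T e0 T0.
have T20 : 0 < T + T by rewrite addr_gt0.
have cz : (fun i => Phi T (z_ i)) @ F --> Phi T z.
  by apply: flow_cvg => //; exact: cvg_cst.
have zd : \forall i \near F, mdist (Phi T z) (Phi T (z_ i)) < eps.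
  exact: metricType_numDomainType.cvgr_dist_lt.
have [i [/= ziy zzi]] :=
  @filter_ex _ F _ _ (@filterI _ F _ _ _ (zy _ _ e0 T20) zd).
have split_time t : T + T <= t ->
    T <= t - T /\ forall x, Phi (t - T) (Phi T x) = Phi t x.
  move=> Tt; have TtT : T <= t - T by rewrite lerBrDr.
  split => // x; have := PhiD (le_trans (ltW T0) TtT) (ltW T0).
  by rewrite subrK => ->.
apply: (chain_cons (lexx T) zzi).
elim/chain_elim: {zzi}(z_ i) / ziy =>
  [x t /split_time[Tt E] xy|x t w /split_time[Tt E] xw wy _].
  by apply: (chain_step Tt); rewrite E.
apply: (chain_cons (y := w) Tt); first by rewrite E.
by apply: chain_weaken wy; rewrite // lerDl ltW.
Qed.

(** The last jump time is lengthened by [s]; continuity of [Phi s] at [y] controls the new error. *)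
Lemma reaches_flow x y s : 0 <= s -> reaches x y -> reaches x (Phi s y).
Proof.
move=> s0 xy eps T e0 T0.
have /metricType_numDomainType.cvgrPdist_lt/(_ _ e0) := @flow_continuous s y.
rewrite -nbhs_ballE => -[d /= d0 dP].
have m0 : 0 < Num.min d eps by rewrite lt_min d0.
have := xy _ _ m0 T0.
move=> h; elim/chain_elim: x / h {xy} => [x t Tt xy|x t w Tt xw wy IH].
  apply: (@chain_step _ _ (s + t)); first by rewrite (le_trans Tt)// lerDr.
  rewrite PhiD//= ?(le_trans (ltW T0) Tt)// metric_sym; apply: dP.
  by rewrite ballEmdist/= metric_sym (lt_le_trans xy)// ge_min lexx.
by apply: (chain_cons Tt) IH; rewrite (lt_le_trans xw)// ge_min lexx orbT.
Qed.

End chains.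

(** * Chain classes and a continuous level function *)

Section isolated_level.
Context {R : realType} {X : metricType R}.
Variables (Phi : R -> X -> X) (rho : X -> R).
Hypothesis cX : compact [set: X].
Hypothesis cPhi : continuous (fun p : R * X => Phi p.1 p.2).
Hypothesis Phi0 : Phi 0 = id.
Hypothesis PhiD : forall t s, 0 <= t -> 0 <= s -> Phi (t + s) = Phi t \o Phi s.
Hypothesis crho : continuous rho.
Implicit Types (x y z p q : X) (eps T t s c : R).

Lemma rho_cvg (I : Type) (F : set_system I) (z_ : I -> X) z :
  Filter F -> z_ @ F --> z -> (fun i => rho (z_ i)) @ F --> rho z.
Proof. by move=> FF; apply: continuous_cvg; exact: crho. Qed.

Lemma limit_class (I : Type) (F : set_system I) (z_ : I -> X) p z :
  ProperFilter F -> z_ @ F --> z ->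
  (forall eps T, 0 < eps -> 0 < T -> \forall i \near F,
    chain Phi eps T p (z_ i) /\ chain Phi eps T (z_ i) p) ->
  chain_class Phi p z.
Proof.
move=> FF zz pz; split.
  apply: reaches_limit zz _ => eps T e0 T0.
  by apply: filterS (pz _ _ e0 T0) => i [].
apply: (@limit_reaches _ _ Phi cPhi PhiD _ F _ _ _ FF zz) => eps T e0 T0.
by apply: filterS (pz _ _ e0 T0) => i [].
Qed.

Lemma chain_class_closed p :
  chain_recurrent Phi p -> closed (chain_class Phi p).
Proof.
move=> pp z pz; pose F := within (chain_class Phi p) (nbhs z).
have FF : ProperFilter F by exact: within_nbhs_proper.
apply: (@limit_class _ F id) => //.
  exact: cvg_within.
move=> eps T e0 T0.
apply: filterS (withinT (chain_class Phi p) (nbhs_filter z)).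
by move=> y [py yp]; split; [exact: py|exact: yp].
Qed.

(** Otherwise nodes of ever finer chains from [p] to [p], all with [rho] below [c / 2], would
    accumulate at a point of the class with [rho] at most [c / 2], which is less than [c]. *)
Lemma chain_node_lower_bound p c : 0 < c -> chain_recurrent Phi p ->
  (forall m, chain_class Phi p m -> c <= rho m) ->
  exists eps T, [/\ 0 < eps, 0 < T & forall z,
    chain Phi eps T p z -> chain Phi eps T z p -> c / 2 <= rho z].
Proof.
move=> c0 pp rhoc; apply: contrapT => nex.
have /choice[z_ z_P] n : exists z, [/\ chain Phi n.+1%:R^-1 n.+1%:R p z,
    chain Phi n.+1%:R^-1 n.+1%:R z p & rho z < c / 2].
  apply: contrapT => nz; apply: nex; exists n.+1%:R^-1, n.+1%:R; split => //.
  move=> z pz zp; rewrite leNgt; apply/negP => zc; apply: nz.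
  by exists z; split.
have [U [UU sU]] := ultraFilterLemma (eventually_filter).
have [z _ zz] : exists2 z, [set: X] z & z_ @ U --> z.
  by apply: compact_ultra_cvg => //; exact: filterE.
have zp : chain_class Phi p z.
  apply: (@limit_class _ U _ _ _ _ zz) => eps T e0 T0.
  apply: sU; apply: filterS (eventually_small_large T e0) => n [ne nT].
  by have [h1 h2 _] := z_P n; split; exact: chain_weaken ne nT _.
have := rhoc _ zp; apply/negP; rewrite -ltNge.
have : rho z <= c / 2.
  apply: (@closed_cvg _ _ U _ (fun n => rho (z_ n)) [set r | r <= c / 2]).
  - exact: closed_le.
  - by apply: filterE => n; have [_ _ /ltW] := z_P n.
  - exact: rho_cvg.
move=> /le_lt_trans; apply; lra.
Qed.

Hypothesis rho_pos : forall z s, 0 <= s -> 0 < rho z -> 0 < rho (Phi s z).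

(* Along ever finer chains from p to a point with rho <= 0 there are points
   z_n with rho = c / 2, on the orbit segment that leads from the last node
   x_n with rho >= c / 2 to the neighbourhood of the next node w_n. They
   accumulate at a point of the chain class of p, since the time from x_n to
   z_n is unbounded (otherwise the limit is on the orbit of lim x_n) and so
   is the time from z_n to w_n (otherwise the orbit of the limit would reach
   rho <= 0). *)
Lemma chain_class_isolated p c : 0 < c -> chain_recurrent Phi p -> c <= rho p ->
  (forall m, chain_class Phi p m -> 0 < rho m -> c <= rho m) ->
  forall m, chain_class Phi p m -> c <= rho m.
Proof.
move=> c0 pp rhop rhoc m pm; have [|rm0] := ltP 0 (rho m); first exact: rhoc.
exfalso.
pose e_ n : R := n.+1%:R^-1; pose T_ n : R := n.+1%:R.
(* [u] packs the crossing jump: the node before it, the node after it, and its time. *)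
have step n : exists u : X * X * R, [/\ T_ n <= u.2,
    mdist (Phi u.2 u.1.1) u.1.2 < e_ n,
    c / 2 <= rho u.1.1 /\ rho u.1.2 < c / 2,
    chain Phi (e_ n) (T_ n) p u.1.1 /\ chain Phi (e_ n) (T_ n) u.1.1 p &
    chain Phi (e_ n) (T_ n) p u.1.2 /\ chain Phi (e_ n) (T_ n) u.1.2 p].
  have e0 : 0 < e_ n by rewrite invr_gt0 ltr0n.
  have T0 : 0 < T_ n by rewrite ltr0n.
  have ppn := pp _ _ e0 T0.
  have mpn := pm.2 _ _ e0 T0.
  have Pp : c / 2 <= rho p by lra.
  have nPm : ~ (c / 2 <= rho m) by apply/negP; rewrite -ltNge; lra.
  have [x [w [t [Tt xw [xc wc] px wm]]]] :=
    chain_crossing (P := fun z => c / 2 <= rho z) (pm.1 _ _ e0 T0) Pp nPm.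
  have px' : chain Phi (e_ n) (T_ n) p x by case: px => [->|].
  have wp : chain Phi (e_ n) (T_ n) w p.
    by case: wm => [->//|/chain_trans]; apply.
  exists (x, w, t); split => //=.
  - by split => //; rewrite ltNge; exact/negP.
  - by split => //; exact: chain_cons Tt xw wp.
  - by split => //; apply: (chain_trans px'); exact: chain_step Tt xw.
have [u_ u_P] := choice step.
pose x_ n := (u_ n).1.1; pose w_ n := (u_ n).1.2; pose t_ n := (u_ n).2.
have [U [UU sU]] := ultraFilterLemma (eventually_filter).
have near_small eps T : 0 < eps -> \forall n \near U, e_ n <= eps /\ T <= T_ n.
  by move=> e0; apply: sU; exact: eventually_small_large.
have ex_lim (y_ : nat -> X) : exists y, y_ @ U --> y.
  have [y _ yy] : exists2 y, [set: X] y & y_ @ U --> y.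
    by apply: compact_ultra_cvg => //; exact: filterE.
  by exists y.
have lim_le (y_ : nat -> X) y a : y_ @ U --> y ->
    (\forall n \near U, rho (y_ n) <= a) -> rho y <= a.
  move=> yy h.
  apply: (@closed_cvg _ _ U _ (fun n => rho (y_ n)) [set r | r <= a]) => //.
  exact: rho_cvg.
have lim_ge (y_ : nat -> X) y a : y_ @ U --> y ->
    (\forall n \near U, a <= rho (y_ n)) -> a <= rho y.
  move=> yy h.
  apply: (@closed_cvg _ _ U _ (fun n => rho (y_ n)) [set r | a <= r]) => //.
  exact: rho_cvg.
have [x xx] := ex_lim x_; have [w ww] := ex_lim w_.
have px : chain_class Phi p x.
  apply: (@limit_class _ U _ _ _ _ xx) => eps T e0 T0.
  apply: filterS (near_small eps T e0) => n [ne nT].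
  by have [_ _ _ [h1 h2] _] := u_P n; split; exact: chain_weaken ne nT _.
have pw : chain_class Phi p w.
  apply: (@limit_class _ U _ _ _ _ ww) => eps T e0 T0.
  apply: filterS (near_small eps T e0) => n [ne nT].
  by have [_ _ _ _ [h1 h2]] := u_P n; split; exact: chain_weaken ne nT _.
(* [w] is in the class with [rho] at most [c / 2], and the class has no positive values below
   [c]. *)
have rw0 : rho w <= 0.
  rewrite leNgt; apply/negP => /(rhoc _ pw) cw.
  have : rho w <= c / 2.
    apply: (lim_le _ _ _ ww); apply: filterE => n.
    by have [_ _ [_ /ltW]] := u_P n.
  lra.
have tw : (fun n => Phi (t_ n) (x_ n)) @ U --> w.
  apply/metricType_numDomainType.cvgrPdist_lt => eps e0.
  have e2 : 0 < eps / 2 by lra.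
  have wd : \forall n \near U, mdist w (w_ n) < eps / 2.
    exact: metricType_numDomainType.cvgr_dist_lt.
  apply: filterS2 wd (near_small _ 0 e2) => n wn [ne _].
  have [_ xw _ _ _] := u_P n.
  rewrite (splitr eps) (le_lt_trans (metric_triangle _ (w_ n) _))// ltrD//.
  by rewrite metric_sym (lt_le_trans xw).
pose crossing n s := [/\ 0 <= s, s <= t_ n & rho (Phi s (x_ n)) = c / 2].
have [s_ s_P] : exists s_ : nat -> R, \forall n \near U, crossing n (s_ n).
  (* The orbit of [x_ n] starts with [rho] at least [c / 2] and, for [U]-almost all [n], ends below
     it, near [w]; the intermediate value theorem applies. *)
  have : \forall n \near U, exists s, crossing n s.
    have : \forall n \near U, rho (Phi (t_ n) (x_ n)) < c / 2.
      apply: (@cvgr_lt _ _ U _ _ (rho w)); first exact: rho_cvg.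
      lra.
    apply: filterS => n tn.
    have [Tt _ [xc _] _ _] := u_P n.
    have t0 : 0 <= t_ n by exact: le_trans Tt.
    have cont : {within `[0, t_ n], continuous (fun s => rho (Phi s (x_ n)))}.
      apply: continuous_subspaceT => s.
      apply: (@continuous_comp _ _ _ (Phi ^~ (x_ n)) rho); last exact: crho.
      by apply: (continuous_curried2 cPhi); [exact: cvg_id|exact: cvg_cst].
    have [|s] := @IVT _ (fun s => rho (Phi s (x_ n))) _ _ (c / 2) t0 cont.
      by rewrite Phi0 ge_min le_max xc (ltW tn) orbT.
    rewrite in_itv/= => /andP[s0 st] E.
    by exists s.
  move=> h; have /choice[s_ s_P] n : exists s,
      (exists s, crossing n s) -> crossing n s.
    have [[s sP]|ns] := pselect (exists s, crossing n s); first by exists s.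
    (* Default for the indices without a crossing, which are negligible for [U]. *)
    by exists 0.
  by exists s_; apply: filterS h => n; exact: s_P.
have [z zz] := ex_lim (fun n => Phi (s_ n) (x_ n)).
have rz : rho z = c / 2.
  apply/eqP; rewrite eq_le (lim_le _ _ _ zz) ?(lim_ge _ _ _ zz)//;
  by apply: filterS s_P => n [_ _ ->].
(* The value [c / 2] lies in the gap, so membership of [z] in the class, shown next, is the
   contradiction. *)
have npz : ~ chain_class Phi p z.
  by move=> /rhoc; rewrite rz => h; have : c <= c / 2; [apply: h|]; lra.
apply: npz; split.
  have [[S sS]|s_large] := ultra_bounded_or_cvgy s_ UU.
    have [s] : exists2 s, `[0, S]%classic s & s_ @ U --> s.
      apply: compact_ultra_cvg; first exact: segment_compact.
      by apply: filterS2 sS s_P => n h1 [h2 _ _]; rewrite /= in_itv/= h2.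
    rewrite /= in_itv/= => /andP[s0 _] ss.
    have -> : z = Phi s x.
      by apply: (cvg_unique _ zz); [exact: metric_hausdorff|exact: flow_cvg].
    by apply: reaches_flow => //; case: px.
  apply: (@reaches_limit _ _ _ _ U _ _ _ _ zz) => eps T e0 T0.
  apply: filterS2 (near_small eps T e0) (s_large T) => n [ne nT] Ts.
  have [_ _ _ [h1 _] _] := u_P n.
  apply: (chain_trans (chain_weaken ne nT h1)).
  by apply: (chain_step Ts); rewrite mdistxx.
apply: (@limit_reaches _ _ Phi cPhi PhiD _ U _ _ _ _ zz) => eps T e0 T0.
have [[S sS]|r_large] := ultra_bounded_or_cvgy (fun n => t_ n - s_ n) UU;
    last first.
  apply: filterS3 (near_small eps T e0) (r_large T) s_P.
  move=> n [ne nT] Ts [s0 st _].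
  have [_ xw _ _ [_ h2]] := u_P n.
  apply: (chain_cons Ts _ (chain_weaken ne nT h2)).
  have := PhiD (le_trans (ltW T0) Ts) s0.
  rewrite subrK => /(congr1 (@^~ (x_ n))) /= <-.
  exact: lt_le_trans xw ne.
exfalso; have [r] : exists2 r, `[0, S]%classic r &
    (fun n => t_ n - s_ n) @ U --> r.
  apply: compact_ultra_cvg; first exact: segment_compact.
  apply: filterS2 sS s_P => n tsS [_ st _].
  by rewrite /= in_itv/= tsS subr_ge0 st.
rewrite /= in_itv/= => /andP[r0 _] rr.
have wE : w = Phi r z.
  apply: (cvg_unique _ tw); first exact: metric_hausdorff.
  have h : (fun n => Phi (t_ n - s_ n) (Phi (s_ n) (x_ n))) @ U --> Phi r z.
    exact: flow_cvg.
  apply: cvg_trans h.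
  apply: near_eq_cvg; apply: filterS s_P => n [s0 st _].
  have ts0 : 0 <= t_ n - s_ n by rewrite subr_ge0.
  by have := PhiD ts0 s0; rewrite subrK => ->.
have : 0 < rho (Phi r z) by apply: rho_pos => //; rewrite rz; lra.
by rewrite -wE; lra.
Qed.

End isolated_level.

(** * Projective spaces and projectivized flows *)

Section projective_space.
Context {R : realType} {H : finHilbertType R}.
Implicit Types (x y : H) (L M : proj_space H).

(** With [k] equal to 1 it also identifies lines built from different proofs that a vector is
    nonzero. *)
Lemma proj_scale x y (x0 : x != 0) (y0 : y != 0) k :
  y = k *: x -> proj y0 = proj x0.
Proof.
move=> yE; apply/val_inj => /=; apply/eqP.
by rewrite eqEdim !dim_vline x0 y0 -memvE yE memvZ ?memv_line.
Qed.

Lemma proj_surj L : exists x (x0 : x != 0), L = proj x0.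
Proof.
have v0 : vpick (sval L) != 0.
  by rewrite vpick0; apply: contraTneq (svalP L) => ->; rewrite dimv0.
exists (vpick (sval L)), v0; apply/val_inj => /=; apply/esym/eqP.
by rewrite eqEdim -memvE memv_pick dim_vline v0 (eqP (svalP L)).
Qed.

Lemma normalize_norm x : x != 0 -> `| `|x|^-1 *: x| = 1.
Proof. by move=> x0; rewrite normrZ normfV normr_id mulVf// normr_eq0. Qed.

Lemma unit_vec_norm L : `|unit_vec L| = 1.
Proof.
have [x [x0 ->]] := proj_surj L.
by have [->|->] := unit_vec_proj x0; rewrite ?normrN normalize_norm.
Qed.

Lemma norm1_neq0 x : `|x| = 1 -> x != 0.
Proof. by move=> x1; rewrite -normr_eq0 x1 oner_eq0. Qed.

Lemma proj_unit_vec L (u0 : unit_vec L != 0) : proj u0 = L.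
Proof.
have [x [x0 LE]] := proj_surj L; rewrite [RHS]LE.
have [uE|uE] := unit_vec_proj x0; rewrite -LE in uE.
  exact: proj_scale uE.
by apply: (@proj_scale _ _ _ _ (- `|x|^-1)); rewrite uE scaleNr.
Qed.

Lemma mdist_proj_le x y (x0 : x != 0) (y0 : y != 0) :
  mdist (proj x0) (proj y0) <= `| `|x|^-1 *: x - `|y|^-1 *: y|.
Proof.
have -> : mdist (proj x0) (proj y0) = proj_dist (proj x0) (proj y0) by [].
by rewrite proj_distE ge_min lexx.
Qed.

(** Choosing the sign of the unit vector of [M] realizes the minimum, so a distance of lines becomes
    a norm of a difference. *)
Lemma representative_at_mdist L M : exists v, [/\ `|v| = 1,
  forall v0 : v != 0, proj v0 = M & `|unit_vec L - v| = mdist L M].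
Proof.
have -> : mdist L M = proj_dist L M by [].
rewrite /proj_dist /Order.min; case: ifP => _.
  by exists (unit_vec M); split; [exact: unit_vec_norm|exact: proj_unit_vec|].
exists (- unit_vec M); split; first by rewrite normrN unit_vec_norm.
  move=> v0; rewrite -[RHS](proj_unit_vec (norm1_neq0 (unit_vec_norm M))).
  by apply: (@proj_scale _ _ _ _ (-1)); rewrite scaleN1r.
by rewrite opprK.
Qed.

(** [unit_vec] is an arbitrary choice of signs, but along an ultrafilter its values still converge
    in the closed unit ball; the limit has norm 1 and spans the limit line. *)
Lemma proj_space_compact : compact [set: proj_space H].
Proof.
rewrite compact_ultra => U UU _.
have [v _ vU] : exists2 v, [set x : H | `|x| <= 1] v & unit_vec @ U --> v.
  apply: compact_ultra_cvg; first exact: closed_ball0_compact.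
  by apply: filterE => L; rewrite /= unit_vec_norm.
have v1 : `|v| = 1.
  have nv : (fun L => `|unit_vec L|) @ U --> `|v| by exact: cvg_norm.
  have n1 : (fun L => `|unit_vec L|) @ U --> (1 : R).
    rewrite (_ : (fun L => _) = cst 1); first exact: cvg_cst.
    by apply/funext => L; rewrite unit_vec_norm.
  exact: (cvg_unique _ nv n1).
exists (proj (norm1_neq0 v1)); split => //=.
apply/metricType_numDomainType.fcvgrPdist_lt => e e0.
have : \forall L \near U, `|v - unit_vec L| < e by exact: cvgr_dist_lt.
apply: filterS => L; apply: le_lt_trans.
rewrite -{1}(proj_unit_vec (norm1_neq0 (unit_vec_norm L))).
by rewrite (le_trans (mdist_proj_le _ _))// v1 unit_vec_norm invr1 !scale1r.
Qed.

End projective_space.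

Section projectivized_flow.
Context {R : realType} {B : metricType R} {H : finHilbertType R}.
Variables (theta : R -> B -> B) (F : R -> B -> H -> H).
Hypothesis ctheta : continuous (fun p : R * B => theta p.1 p.2).
Hypothesis cF : continuous (fun p : R * (B * H) => F p.1 p.2.1 p.2.2).
Hypothesis linF : forall t b, linear (F t b).
Hypothesis F_neq0 : forall t b x, x != 0 -> F t b x != 0.

Lemma proj_flow_proj t b x (x0 : x != 0) :
  proj_flow theta F t (b, proj x0) = (theta t b, proj (F_neq0 t b x0)).
Proof.
by rewrite /proj_flow /skew_prod/= (proj_map_proj x0 (F_neq0 t b x0)).
Qed.

(** Near [L] a line is represented by its unit vector closest to [unit_vec L]; the continuity of the
    normalized vector map at [unit_vec L] then bounds the distance of the image lines. *)
Lemma proj_flow_continuous :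
  continuous (fun p : R * (B * proj_space H) => proj_flow theta F p.1 p.2).
Proof.
move=> [t [b L]].
apply: (@continuous_pairing _ _ _
  (fun p : R * (B * proj_space H) => theta p.1 p.2.1)
  (fun p => proj_map (F p.1 p.2.1) p.2.2)).
  apply: (continuous_curried2 ctheta); first exact: cvg_fst.
  apply: (@continuous_comp _ _ _ snd fst); [exact: cvg_snd|exact: cvg_fst].
apply/metricType_numDomainType.cvgrPdist_lt => e e0.
have u1 := unit_vec_norm L; have u0 := norm1_neq0 u1.
pose N (p : R * (B * H)) := `|F p.1 p.2.1 p.2.2|^-1 *: F p.1 p.2.1 p.2.2.
have : \forall p \near (t, (b, unit_vec L)),
    `|N (t, (b, unit_vec L)) - N p| < e.
  have cFu := @cF (t, (b, unit_vec L)).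
  have nFu : `|F t b (unit_vec L)| != 0 by rewrite normr_eq0 F_neq0.
  have : {for (t, (b, unit_vec L)), continuous N}.
    exact: (cvgZ (cvgV nFu (cvg_norm cFu)) cFu).
  by move=> /cvgrPdist_lt; apply.
move=> /nbhs_ballP[r /= r0 rN].
apply: filterS (nbhsx_ballx (t, (b, L)) _ r0).
move=> -[t' [b' M]] [/= tt' [/= bb' LM]].
have [v [v1 vM vL]] := representative_at_mdist L M.
have v0 := norm1_neq0 v1.
have bv : ball (t, (b, unit_vec L)) r (t', (b', v)).
  split => //; split => //=.
  by rewrite -ball_normE/= vL; move: LM; rewrite ballEmdist.
apply: le_lt_trans (rN _ bv).
rewrite -{1}(proj_unit_vec u0) -{1}(vM v0).
rewrite (proj_map_proj u0 (F_neq0 t b u0))//.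
rewrite (proj_map_proj v0 (F_neq0 t' b' v0))//.
exact: mdist_proj_le.
Qed.

Lemma proj_flowD t s : theta (t + s) = theta t \o theta s ->
  (forall b x, F (t + s) b x = F t (theta s b) (F s b x)) ->
  proj_flow theta F (t + s) = proj_flow theta F t \o proj_flow theta F s.
Proof.
move=> thetaD FD; apply/funext => -[b L] /=; have [x [x0 ->]] := proj_surj L.
rewrite !proj_flow_proj thetaD/=; congr pair.
by apply: (@proj_scale _ _ _ _ _ _ 1); rewrite scale1r FD.
Qed.

Lemma proj_flow0 : theta 0 = id -> (forall b x, F 0 b x = x) ->
  proj_flow theta F 0 = id.
Proof.
move=> theta0 F0; apply/funext => -[b L] /=; have [x [x0 ->]] := proj_surj L.
rewrite proj_flow_proj theta0/=; congr pair.
by apply: (@proj_scale _ _ _ _ _ _ 1); rewrite scale1r F0.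
Qed.

End projectivized_flow.

(** * Norms, heights and the chart [h1] on the extended space *)

Section extended_space.
Context {R : realType} {B : metricType R} {H : finHilbertType R}.
Implicit Types (z w : hext H) (L M : proj_space (hext H)) (p q : B * H).

Lemma sqr_norm_inner (V : finHilbertType R) (x : V) : `|x| ^+ 2 = inner x x.
Proof.
rewrite normr_inner sqr_sqrtr//; have [->|x0] := eqVneq x 0.
  by rewrite linear0r.
exact/ltW/neq0_dnorm_gt0.
Qed.

Lemma sqr_hext_norm z : `|z| ^+ 2 = `|z.1| ^+ 2 + z.2 ^+ 2.
Proof. by rewrite (@sqr_norm_inner (hext H)) (@sqr_norm_inner H) expr2. Qed.

Lemma hext_norm_fst z : `|z.1| <= `|z|.
Proof.
by rewrite -(@ler_pXn2r _ 2)// ?nnegrE// sqr_hext_norm lerDl sqr_ge0.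
Qed.

Lemma hext_norm_snd z : `|z.2| <= `|z|.
Proof.
rewrite -(@ler_pXn2r _ 2)// ?nnegrE// sqr_hext_norm real_normK ?num_real//.
by rewrite lerDr sqr_ge0.
Qed.

Lemma hext_norm_le z : `|z| <= `|z.1| + `|z.2|.
Proof.
rewrite -(@ler_pXn2r _ 2)// ?nnegrE ?addr_ge0// sqr_hext_norm sqrrD.
rewrite real_normK ?num_real// lerD2r lerDl.
by rewrite mulrn_wge0// mulr_ge0.
Qed.

Lemma hext_fst_continuous : continuous (fun z => z.1).
Proof.
move=> z; apply/(@cvgrPdist_lt _ _ _ _ (nbhs_filter z)) => e e0.
apply: filterS (nbhsx_ballx z _ e0) => w; rewrite -ball_normE /=.
exact/le_lt_trans/(hext_norm_fst (z - w)).
Qed.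

Lemma hext_snd_continuous : continuous (fun z => z.2).
Proof.
move=> z; apply/(@cvgrPdist_lt _ _ _ _ (nbhs_filter z)) => e e0.
apply: filterS (nbhsx_ballx z _ e0) => w; rewrite -ball_normE /=.
exact/le_lt_trans/(hext_norm_snd (z - w)).
Qed.

Lemma continuous_hext_pair (T : topologicalType) (g : T -> H) (h : T -> R) x :
  {for x, continuous g} -> {for x, continuous h} ->
  {for x, continuous (fun y => (g y, h y) : hext H)}.
Proof.
move=> cg ch; apply/cvgrPdist_lt => e e0.
have e2 : 0 < e / 2 by rewrite divr_gt0.
have gd : \forall y \near x, `|g x - g y| < e / 2.
  by move/cvgrPdist_lt : cg; apply.
have hd : \forall y \near x, `|h x - h y| < e / 2.
  by move/cvgrPdist_lt : ch; apply.
apply: filterS2 gd hd => y gy hy.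
rewrite (le_lt_trans (hext_norm_le ((g x, h x) - (g y, h y) : hext H)))//=.
by rewrite (splitr e) ltrD.
Qed.

Lemma prod_mdistE (U V : metricType R) (u v : U * V) :
  mdist u v = Num.max (mdist u.1 v.1) (mdist u.2 v.2).
Proof. by []. Qed.

(** The cosine of the angle between the line and the axis {0} x R; the absolute value removes the
    sign chosen by [unit_vec]. *)
Definition height (p : B * proj_space (hext H)) : R := `|(unit_vec p.2).2|.

Lemma height_proj b z (z0 : z != 0) : height (b, proj z0) = `|z.2| / `|z|.
Proof.
change (`|(unit_vec (proj z0)).2| = `|z.2| / `|z|).
have [->|->] := unit_vec_proj z0; rewrite /= ?normrN;
by rewrite normrM normfV normr_id mulrC.
Qed.

Lemma height_lipschitz (P Q : B * proj_space (hext H)) :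
  `|height P - height Q| <= mdist P Q.
Proof.
case: P Q => [b L] [b' M]; rewrite prod_mdistE le_max; apply/orP; right => /=.
have [v [v1 vM vL]] := representative_at_mdist L M.
have -> : height (b', M) = `|v.2|.
  by rewrite -(vM (norm1_neq0 v1)) height_proj v1 divr1.
rewrite (le_trans (ler_dist_dist _ _))// -vL.
exact: (hext_norm_snd (unit_vec L - v)).
Qed.

Lemma height_continuous : continuous height.
Proof.
move=> P; apply/cvgrPdist_lt => e e0.
apply: filterS (nbhsx_ballx P _ e0) => Q; rewrite ballEmdist /=.
exact/le_lt_trans/height_lipschitz.
Qed.

Lemma proj_hext1P b L : proj_hext1 L <-> 0 < height (b, L).
Proof.
split=> [[z [z0 [z2 ->]]]|].
  by rewrite height_proj divr_gt0 ?normr_gt0.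
have [z [z0 ->]] := proj_surj L; rewrite height_proj => h.
exists z, z0; split => //; apply/eqP => z2.
by rewrite z2 normr0 mul0r ltxx in h.
Qed.

Lemma h1_surj b L : 0 < height (b, L) -> exists x : H, h1 (b, x) = (b, L).
Proof.
have [z [z0 ->]] := proj_surj L; rewrite height_proj => h.
have z2 : z.2 != 0 by apply/eqP => z2; rewrite z2 normr0 mul0r ltxx in h.
exists (z.2^-1 *: z.1); congr pair.
apply: (@proj_scale _ _ _ _ _ _ (z.2^-1)).
by congr pair; exact/esym/mulVf.
Qed.

Lemma hext1_norm_ge1 (x : H) : 1 <= `|(x, 1) : hext H|.
Proof. by have := hext_norm_snd (x, 1); rewrite /= normr1. Qed.

Lemma height_h1 p : height (h1 p) = `|(p.2, 1) : hext H|^-1.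
Proof. by rewrite height_proj /= normr1 div1r. Qed.

(** The difference splits into a term for the vectors and a term for the norms, each at most the
    distance of [x] and [y] because the norm of [x] is at least 1. *)
Lemma normalize_lipschitz (V : normedModType R) (x y : V) :
  1 <= `|x| -> y != 0 ->
  `| `|x|^-1 *: x - `|y|^-1 *: y| <= 2 * `|x - y|.
Proof.
move=> x1 y0; have ny0 : 0 < `|y| by rewrite normr_gt0.
have nx0 : 0 < `|x| by exact: lt_le_trans x1.
have -> : `|x|^-1 *: x - `|y|^-1 *: y =
    `|x|^-1 *: (x - y) + (`|x|^-1 * (`|y| - `|x|)) *: (`|y|^-1 *: y).
  rewrite scalerBr scalerA mulrBr mulVf ?gt_eqF// mulrBl mul1r.
  by rewrite -mulrA mulfV ?gt_eqF// mulr1 scalerBl addrA subrK.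
rewrite (le_trans (ler_normD _ _))// !normrZ !normfV !normr_id.
rewrite mulVf ?gt_eqF// mulr1.
rewrite mulrDl mul1r lerD//.
  by rewrite ler_piMl// invf_le1.
rewrite (le_trans (y := `| `|y| - `|x| |))//.
  by rewrite ler_piMl// invf_le1.
by rewrite distrC ler_dist_dist.
Qed.

Lemma h1_lipschitz p q : mdist (h1 p) (h1 q) <= 2 * mdist p q.
Proof.
rewrite !prod_mdistE /= maxr_pMr// ge_max; apply/andP; split.
  by rewrite le_max ler_peMl ?mdist_ge0// ler1n.
rewrite le_max; apply/orP; right; rewrite (le_trans (mdist_proj_le _ _))//.
rewrite (le_trans (normalize_lipschitz (hext1_norm_ge1 _) (pair1_neq0 _)))//.
rewrite ler_pM2l// mdist_norm (le_trans (hext_norm_le _))//=.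
by rewrite subrr normr0 addr0.
Qed.

(** The unit vectors [u], [v] of the lines have last coordinates 1/m and 1/n, where m and n are at
    most 1/a. The norms are thus recovered from last coordinates at the cost of a factor mn, and
    both m and mn are at most 1/a^2. *)
Lemma h1_inverse_lipschitz a p q : 0 < a -> a <= 1 ->
  a <= height (h1 p) -> a <= height (h1 q) ->
  mdist p q <= 2 / a ^+ 2 * mdist (h1 p) (h1 q).
Proof.
move=> a0 a1; rewrite !height_h1.
set m := `|_|; set n := `|_| => am an.
have m0 : 0 < m by rewrite (lt_le_trans _ (hext1_norm_ge1 _)).
have n0 : 0 < n by rewrite (lt_le_trans _ (hext1_norm_ge1 _)).
have ma : m <= a^-1 by rewrite -(invrK m) lef_pV2 ?posrE ?invr_gt0.
have na : n <= a^-1 by rewrite -(invrK n) lef_pV2 ?posrE ?invr_gt0.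
have C1 : 1 <= 2 / a ^+ 2.
  rewrite ler_pdivlMr ?exprn_gt0// mul1r.
  by rewrite (le_trans (exprn_ile1 2 (ltW a0) a1))// ler1n.
rewrite !prod_mdistE /= maxr_pMr ?(le_trans ler01 C1)// ge_max.
apply/andP; split.
  by rewrite le_max ler_peMl ?mdist_ge0.
rewrite le_max; apply/orP; right; rewrite mdist_norm.
have -> : mdist (proj (pair1_neq0 p.2)) (proj (pair1_neq0 q.2)) =
  proj_dist (proj (pair1_neq0 p.2)) (proj (pair1_neq0 q.2)) by [].
rewrite proj_distE -/m -/n.
set P : hext H := (p.2, 1) in m am m0 ma *.
set Q : hext H := (q.2, 1) in n an n0 na *.
set u := m^-1 *: P; set v := n^-1 *: Q.
have K1 : 1 <= a^-1 by rewrite invf_ge1.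
have mn0 : 0 < m * n by rewrite mulr_gt0.
have mnK : m * n <= a^-1 ^+ 2 by rewrite expr2 ler_pM// ltW.
have mK : m <= a^-1 ^+ 2.
  by rewrite (le_trans ma)// expr2 ler_peMl// invr_ge0 ltW.
have vn : `|v| = 1 by apply: normalize_norm; exact: pair1_neq0.
have mu : P = m *: u by rewrite scalerA mulfV ?gt_eqF// scale1r.
have nv : Q = n *: v by rewrite scalerA mulfV ?gt_eqF// scale1r.
have PQ : `|p.2 - q.2| <= `|P - Q| by exact: (hext_norm_fst (P - Q)).
rewrite -exprVn; apply: (le_trans PQ).
have u2 : u.2 = m^-1 by exact: mulr1.
have v2 : v.2 = n^-1 by exact: mulr1.
move: u v vn mu nv u2 v2 => u v vn mu nv u2 v2.
rewrite /Order.min; case: ifP => _.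
  have -> : P - Q = m *: (u - v) + (m - n) *: v.
    by rewrite {1}mu {1}nv scalerBr scalerBl addrA subrK.
  rewrite (le_trans (ler_normD _ _))// !normrZ vn mulr1 (gtr0_norm m0).
  have mnuv : `|m - n| <= m * n * `|u - v|.
    have := hext_norm_snd (u - v).
    rewrite (_ : (u - v).2 = m^-1 - n^-1); last by rewrite -u2 -v2.
    move=> h; have -> : m - n = - (m * n * (m^-1 - n^-1)).
      by field; rewrite !gt_eqF.
    by rewrite normrN normrM (gtr0_norm mn0) ler_pM2l.
  have := normr_ge0 (u - v); nra.
(* When opposite signs are nearer, the last coordinates add up, so [u + v] is large enough to
   dominate the crude bound m + n. *)
have mnuv : m + n <= m * n * `|u + v|.
  have := hext_norm_snd (u + v).
  rewrite (_ : (u + v).2 = m^-1 + n^-1); last by rewrite -u2 -v2.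
  rewrite ger0_norm; last by rewrite addr_ge0// invr_ge0 ltW.
  move=> h.
  have -> : m + n = m * n * (m^-1 + n^-1) by field; rewrite !gt_eqF.
  by rewrite ler_pM2l.
have : `|P - Q| <= m + n by rewrite (le_trans (ler_normB _ _)).
have := normr_ge0 (u + v); nra.
Qed.

End extended_space.

(** * The lift of an affine flow *)

Section selgrade.
Context {R : realType} {B : metricType R} {H : finHilbertType R}.

(** Recovers the chain component from its Selgrade bundle. *)
Lemma proj_set_bundle_of (M : set (B * proj_space H)) :
  proj_set (bundle_of M) = M.
Proof.
apply/seteqP; split => -[b L] /=.
  by move=> [x [x0 [Mx /= ->]]]; exact: Mx.
have [x [x0 ->]] := proj_surj L => MbL.
exists x, x0; split => // x0' /=.
by rewrite (@proj_scale _ _ _ _ x0 x0' 1) ?scale1r.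
Qed.

End selgrade.

Lemma chain_image (R : realType) (X Y : metricType R) (Phi : R -> X -> X)
    (Phi' : R -> Y -> Y) (h : X -> Y) (K d T : R) x y : 0 < K ->
  (forall t x, Phi' t (h x) = h (Phi t x)) ->
  (forall x y, mdist (h x) (h y) <= K * mdist x y) ->
  chain Phi d T x y -> chain Phi' (K * d) T (h x) (h y).
Proof.
move=> K0 hPhi hK xy.
elim/(@chain_elim _ _ Phi): x / xy => [x t Tt xy|x t z Tt xz _].
  apply: (chain_step Tt); rewrite hPhi (le_lt_trans (hK _ _))//.
  by rewrite ltr_pM2l.
apply: (chain_cons Tt); rewrite hPhi (le_lt_trans (hK _ _))//.
by rewrite ltr_pM2l.
Qed.

Section affine.
Context {R : realType} {B : metricType R} {H : finHilbertType R}.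
Variables (theta : R -> B -> B) (phi psi : R -> B -> H -> H) (f : B -> R -> H).
Hypothesis cB : compact [set: B].
Hypothesis thetaF : is_flow theta.
Hypothesis aff : affine_flow theta phi f psi.
Local Notation Psi := (skew_prod theta psi).
Local Notation Lift := (lift theta phi f).
Local Notation PLift := (proj_flow theta Lift).

Let lin_phi t b : linear (phi t b).
Proof. by case: aff => [[]]. Qed.

Let phiD t s b x : phi (t + s) b x = phi t (theta s b) (phi s b x).
Proof.
case: aff => [[[_ _ h] _] _ _ _ _].
exact: (congr1 (fun F => (F (b, x)).2) (h t s)).
Qed.

Let phi0 b x : phi 0 b x = x.
Proof.
case: aff => [[[_ h _] _] _ _ _ _].
exact: (congr1 (fun F => (F (b, x)).2) h).
Qed.

Let phi_neq0 t b x : x != 0 -> phi t b x != 0.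
Proof.
apply: contra_neq => tx0; rewrite -(phi0 b x) -(addNr t) phiD tx0.
exact: (phi0r aff).
Qed.

Lemma lift_linear t b : linear (Lift t b).
Proof.
move=> k z w; congr pair; rewrite /= lin_phi scalerDr -!addrA; congr (_ + _).
rewrite addrCA; congr (_ + _).
by rewrite scalerA -scalerDl.
Qed.

(** The lift keeps the last coordinate, and where that is 0 it acts as the injective [phi t b].
    Hence [proj_map] never takes its default value. *)
Lemma lift_neq0 t b z : z != 0 -> Lift t b z != 0.
Proof.
apply: contra_neq => /[dup] /(congr1 snd) /= z2 /(congr1 fst) /=.
rewrite z2 scale0r addr0 => z1; case: z z1 z2 => x r /= z1 ->.
congr pair; apply/eqP; apply: contraTT isT => x0.
by move: (phi_neq0 t b x0); rewrite z1 eqxx.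
Qed.

Lemma lift_continuous :
  continuous (fun p : R * (B * hext H) => Lift p.1 p.2.1 p.2.2).
Proof.
move=> p.
have c1 : {for p, continuous (fun p : R * (B * hext H) => p.1)}.
  exact: cvg_fst.
have c2 : {for p, continuous (fun p : R * (B * hext H) => p.2.2)}.
  by apply: (@continuous_comp _ _ _ snd snd); exact: cvg_snd.
have c21 : {for p, continuous (fun p : R * (B * hext H) => p.2.1)}.
  by apply: (@continuous_comp _ _ _ snd fst); [exact: cvg_snd|exact: cvg_fst].
have cfst : {for p, continuous (fun p : R * (B * hext H) => p.2.2.1)}.
  by apply: (continuous_comp c2); exact: hext_fst_continuous.
have csnd : {for p, continuous (fun p : R * (B * hext H) => p.2.2.2)}.
  by apply: (continuous_comp c2); exact: hext_snd_continuous.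
have := @continuous_hext_pair R H (R * (B * hext H))%type
  (fun p => phi p.1 p.2.1 p.2.2.1 +
     p.2.2.2 *: affine_term theta phi f p.1 p.2.1) (fun p => p.2.2.2) p.
apply => //.
apply: cvgD.
  exact: (@continuous_curried3 (R * (B * hext H))%type _ _ _ _ phi
    (fun p => p.1) (fun p => p.2.1) (fun p => p.2.2.1) p
    (phi_continuous aff) c1 c21 cfst).
apply: cvgZ => //.
exact: (@continuous_curried2 (R * (B * hext H))%type _ _ _
  (affine_term theta phi f) (fun p => p.1) (fun p => p.2.1) p
  (affine_term_continuous aff) c1 c21).
Qed.

(** At times 0 and 0 the cocycle identity reads a = a + a. *)
Lemma affine_term0 b : affine_term theta phi f 0 b = 0.
Proof.
case: thetaF => _ theta0 _.
have := affine_term_cocycle thetaF aff b (lexx 0) (lexx 0).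
rewrite addr0 theta0 phi0 => /eqP.
by rewrite -[X in X == _]addr0 (inj_eq (addrI _)) => /eqP/esym.
Qed.

Lemma PLift_continuous :
  continuous (fun p : R * (B * proj_space (hext H)) => PLift p.1 p.2).
Proof.
apply: proj_flow_continuous;
  [by case: thetaF|exact: lift_continuous|exact: lift_linear|exact: lift_neq0].
Qed.

Lemma PLift0 : PLift 0 = id.
Proof.
apply: proj_flow0; [exact: lift_linear|exact: lift_neq0|by case: thetaF|].
by move=> b [x r]; rewrite /lift/= affine_term0 phi0 scaler0 addr0.
Qed.

Lemma PLiftD t s : 0 <= t -> 0 <= s -> PLift (t + s) = PLift t \o PLift s.
Proof.
move=> t0 s0; apply: proj_flowD;
  [exact: lift_linear|exact: lift_neq0|by case: thetaF|].
move=> b [x r]; congr pair; rewrite /= phiD (affine_term_cocycle thetaF aff)//.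
have lDZ k y z : phi t (theta s b) (y + k *: z) =
    phi t (theta s b) y + k *: phi t (theta s b) z.
  by rewrite addrC lin_phi addrC.
by rewrite lDZ scalerDr addrA.
Qed.

Lemma PLift_h1 t p : PLift t (h1 p) = h1 (Psi t p).
Proof.
rewrite /h1 (proj_flow_proj _ lift_linear lift_neq0); congr pair.
apply: (@proj_scale _ _ _ _ _ _ 1); rewrite scale1r /=; congr pair.
by case: aff => _ _ _ -> _ /=; rewrite scale1r.
Qed.

Lemma height_PLift_gt0 q t : 0 < height q -> 0 < height (PLift t q).
Proof.
case: q => b L; have [z [z0 ->]] := proj_surj L.
rewrite (proj_flow_proj _ lift_linear lift_neq0) !height_proj => h.
have z2 : z.2 != 0 by apply/eqP => z2; rewrite z2 normr0 mul0r ltxx in h.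
by rewrite divr_gt0 ?normr_gt0// lift_neq0.
Qed.

Lemma phase_compact : compact [set: B * proj_space (hext H)].
Proof.
by rewrite -setXTT; apply: compact_setX => //; exact: proj_space_compact.
Qed.

Lemma h1_continuous : continuous (@h1 R B H).
Proof.
move=> p; apply/metricType_numDomainType.cvgrPdist_lt => e e0.
have e2 : 0 < e / 2 by rewrite divr_gt0.
apply: filterS (nbhsx_ballx p _ e2) => q; rewrite ballEmdist/= => pq.
rewrite (le_lt_trans (h1_lipschitz _ _))//.
by rewrite -ltr_pdivlMl// mulrC.
Qed.

Lemma chain_recurrent_h1 p :
  chain_recurrent Psi p -> chain_recurrent PLift (h1 p).
Proof.
move=> pp eps T e0 T0.
have e2 : 0 < eps / 2 by rewrite divr_gt0.
have := chain_image (ltr0Sn R 1) PLift_h1 (@h1_lipschitz _ _ _) (pp _ _ e2 T0).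
by rewrite mulrC divfK.
Qed.

Lemma h1_height_gt0 (p : B * H) : 0 < height (h1 p).
Proof. by rewrite height_h1 invr_gt0 (lt_le_trans _ (hext1_norm_ge1 _)). Qed.

(** * Chain components of the projectivized lift *)

Variable M : set (B * proj_space (hext H)).
Hypothesis compM : chain_component PLift M.
Local Notation N := (h1 @^-1` M).

Let recM m : M m -> chain_recurrent PLift m.
Proof. by move=> Mm eps T e0 T0; exact: compM.1. Qed.

Let M_class m : M m -> M = chain_class PLift m.
Proof. exact: component_chain_class. Qed.

Lemma component_compact : compact M.
Proof.
have [[m Mm]|M0] := pselect (M !=set0); last first.
  by move/set0P/negP/negPn/eqP : M0 => ->; exact: compact0.
apply: (subclosed_compact _ phase_compact) => //.
rewrite (M_class Mm); apply: chain_class_closed => //.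
- exact: PLift_continuous.
- exact: PLiftD.
- exact: recM.
Qed.

(** The image under [h1] of an ultrafilter on [N] converges in the compact [M]; the limit has
    positive height, and near it the Lipschitz inverse of [h1] pulls the convergence back. *)
Lemma preimage_h1_compact : (forall m, M m -> 0 < height m) -> compact N.
Proof.
move=> Mpos; rewrite compact_ultra => U UU NU.
have [m Mm hm] : exists2 m, M m & @h1 R B H @ U --> m.
  exact: compact_ultra_cvg component_compact _.
have hm0 := Mpos _ Mm; case: m Mm hm hm0 => b L Mm hm hm0.
have [x hx] := h1_surj hm0; rewrite -hx in Mm hm hm0.
exists (b, x); split => //=.
apply/metricType_numDomainType.fcvgrPdist_lt => e e0.
pose a := Num.min (height (h1 (b, x)) / 2) 1.
have a0 : 0 < a by rewrite lt_min ltr01 divr_gt0.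
have a1 : a <= 1 by rewrite ge_min lexx orbT.
have ah : a < height (h1 (b, x)) by rewrite gt_min; apply/orP; left; lra.
have K0 : 0 < 2 / a ^+ 2 by rewrite divr_gt0// exprn_gt0.
have near_a : \forall u \near U, a <= height (h1 u).
  apply: (@cvgr_ge _ _ U _ (fun u => height (h1 u)) (height (h1 (b, x)))) => //.
  by apply: rho_cvg hm; exact: height_continuous.
have near_e : \forall u \near U, mdist (h1 (b, x)) (h1 u) < e / (2 / a ^+ 2).
  by apply: metricType_numDomainType.cvgr_dist_lt => //; rewrite divr_gt0.
apply: filterS2 near_a near_e => u au eu.
rewrite (le_lt_trans (h1_inverse_lipschitz a0 a1 (ltW ah) au))//.
by rewrite mulrC -ltr_pdivlMr.
Qed.

(** The height attains its minimum over [N] at some [n]. Points of [M] of positive height come from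
    [N], so this minimum is the edge of a gap, and [h1 n] lies on it. *)
Lemma component_height_lower_bound : N !=set0 -> compact N ->
  exists2 c, 0 < c & forall m, M m -> c <= height m.
Proof.
move=> N0 cN.
have cont : {within N, continuous (fun p => height (h1 p))}.
  apply: continuous_subspaceT => p.
  by apply: continuous_comp; [exact: h1_continuous|exact: height_continuous].
have [n /set_mem Nn nmin] := compact_EVT_min N0 cN cont.
exists (height (h1 n)); first exact: h1_height_gt0.
move=> m Mm; rewrite (M_class Nn) in Mm.
apply: (chain_class_isolated phase_compact PLift_continuous PLift0 PLiftD
  height_continuous _ (h1_height_gt0 n) (recM Nn) (lexx _)) Mm.
  by move=> z s _; exact: height_PLift_gt0.
move=> [b L]; rewrite -(M_class Nn) => Mm /h1_surj[x hx].
by rewrite -hx; apply: nmin; rewrite inE /= hx.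
Qed.

Lemma chain_recurrent_of_component n : M (h1 n) ->
  (exists2 c, 0 < c & forall m, M m -> c <= height m) -> chain_recurrent Psi n.
Proof.
move=> Mn [c c0 hc].
have c42 : c / 4 <= c / 2 by lra.
have quarter x y r : c / 2 <= y -> r <= c / 4 -> - r <= x - y -> c / 4 <= x.
  lra.
move=> eps T e0 T0.
have hc' m : chain_class PLift (h1 n) m -> c <= height m.
  by rewrite -(M_class Mn); exact: hc.
have [e1 [T1 [e10 T10 node]]] :=
  chain_node_lower_bound phase_compact PLift_continuous PLiftD
    height_continuous c0 (recM Mn) hc'.
pose a := Num.min (c / 4) 1.
have a0 : 0 < a by rewrite lt_min ltr01 divr_gt0.
have a1 : a <= 1 by rewrite ge_min lexx orbT.
have ac : a <= c / 4 by rewrite ge_min lexx.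
have K0 : 0 < 2 / a ^+ 2 by rewrite divr_gt0// exprn_gt0.
(* [e1] keeps the nodes at height [c / 2]; [c / 4] keeps the points from which the jumps are made,
   which are not nodes, at height [c / 4]; the last bound makes the pulled back jumps smaller than
   [eps]. *)
pose d := Num.min e1 (Num.min (c / 4) (eps / (2 / a ^+ 2))).
have d0 : 0 < d by rewrite !lt_min e10 /=; apply/andP; split; apply: divr_gt0.
have de : d <= e1 by rewrite ge_min lexx.
have dc : d <= c / 4 by rewrite !ge_min lexx orbT.
have dK : 2 / a ^+ 2 * d <= eps.
  by rewrite mulrC -ler_pdivlMr// !ge_min lexx !orbT.
have TT : 0 < Num.max T T1 by rewrite lt_max T0.
have T_le : T <= Num.max T T1 by rewrite le_max lexx.
have T1_le : T1 <= Num.max T T1 by rewrite le_max lexx orbT.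
have nn := recM Mn d0 TT.
have jump u v : c / 2 <= height (h1 v) ->
    mdist (h1 u) (h1 v) < d -> mdist u v < eps.
  move=> hv uv; have := height_lipschitz (h1 u) (h1 v).
  rewrite ler_norml => /andP[hu _].
  have au : a <= height (h1 u).
    exact: le_trans ac (quarter _ _ _ hv (le_trans (ltW uv) dc) hu).
  have av : a <= height (h1 v) by exact: le_trans ac (le_trans c42 hv).
  apply: (le_lt_trans (h1_inverse_lipschitz a0 a1 au av)).
  by apply: lt_le_trans dK; rewrite ltr_pM2l.
have node' z : chain PLift d (Num.max T T1) (h1 n) z ->
    chain PLift d (Num.max T T1) z (h1 n) -> c / 2 <= height z.
  move=> nz zn.
  exact: node (chain_weaken de T1_le nz) (chain_weaken de T1_le zn).
(* The induction carries a chain from [h1 n] to [z], so that every later node has chains both ways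
   and its height is controlled. *)
suff H0 z : chain PLift d (Num.max T T1) z (h1 n) ->
    chain PLift d (Num.max T T1) (h1 n) z ->
    forall u, h1 u = z -> chain Psi eps T u n.
  exact: (H0 _ nn nn _ erefl).
apply: (@chain_elim _ _ PLift _ _ _ (fun z =>
  chain PLift d (Num.max T T1) (h1 n) z ->
  forall u, h1 u = z -> chain Psi eps T u n)) => {}z t.
  move=> Tt zn nz u uz.
  apply: (chain_step (le_trans T_le Tt)); apply: jump; first exact: node'.
  by rewrite -PLift_h1 uz.
move=> w Tt zw wn IH nz u uz.
have nw : chain PLift d (Num.max T T1) (h1 n) w.
  by apply: (chain_trans nz); exact: chain_step Tt zw.
have hw := node' _ nw wn.
have [v vw] : exists v : B * H, h1 v = w.
  case: w zw wn IH nw hw => b L _ _ _ _ hw.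
  have [|x xL] := @h1_surj _ _ _ b L; first by lra.
  by exists (b, x).
apply: (chain_cons (le_trans T_le Tt) _ (IH nw v vw)).
apply: jump; first by rewrite vw.
by rewrite -PLift_h1 uz vw.
Qed.

End affine.

Theorem corollary14 (R : realType) (B : metricType R) (H : finHilbertType R)
    (theta : R -> B -> B) (phi psi : R -> B -> H -> H) (f : B -> R -> H)
    (Vc : set (B * hext H)) :
  compact [set: B] ->
  is_flow theta ->
  chain_transitive theta [set: B] ->
  affine_flow theta phi f psi ->
  central_selgrade_bundle theta phi f Vc ->
  let Psi := skew_prod theta psi in
  let Mc : set (B * proj_space (hext H)) := proj_set Vc in
  let Nc : set (B * H) := h1 @^-1` (Mc `&` ([set: B] `*` proj_hext1)) in
  (forall p : B * H, chain_recurrent Psi p -> Mc (h1 p)) /\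
  (Mc `<=` [set: B] `*` proj_hext1 <-> compact Nc) /\
  (Mc `<=` [set: B] `*` proj_hext1 ->
     Nc = h1 @^-1` Mc /\ h1 @^-1` Mc = chain_recurrent Psi).
Proof.
move=> cB thetaF _ aff [[[M compM VcE] [[b z] [Vcz [_ z2]]]] uniqVc] Psi Mc Nc.
have McE : Mc = M by rewrite /Mc VcE proj_set_bundle_of.
have z0 : z != 0 by apply: contraNneq z2 => ->.
have Mz : M (b, proj z0) by rewrite VcE in Vcz; exact: Vcz.
have NcE : Nc = h1 @^-1` M.
  rewrite /Nc McE; apply/seteqP; split => [p []//|p Mp].
  split => //; split => //.
  by apply/(proj_hext1P (h1 p).1); exact: h1_height_gt0.
have N0 : h1 @^-1` M !=set0.
  have [|x hx] := @h1_surj _ _ _ b (proj z0).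
    by rewrite height_proj divr_gt0 ?normr_gt0.
  by exists (b, x); rewrite /= hx.
have recMc p : chain_recurrent Psi p -> Mc (h1 p).
  move=> /(chain_recurrent_h1 aff) rp.
  set K := chain_class (proj_flow theta (lift theta phi f)) (h1 p).
  have Kp : K (h1 p) by [].
  (* The bundle of the class of [h1 p] contains the vector (p.2, 1) over p.1, so by uniqueness it is
     [Vc]. *)
  rewrite /Mc (uniqVc (bundle_of K)) ?proj_set_bundle_of//.
  split; first by exists K => //; exact: chain_class_component.
  exists (p.1, (p.2, 1)); split.
    by move=> x0; rewrite (@proj_scale _ _ _ _ (pair1_neq0 p.2) x0 1) ?scale1r.
  by split => //=; rewrite /hext1/= oner_eq0.
have compact_of_sub : Mc `<=` [set: B] `*` proj_hext1 -> compact (h1 @^-1` M).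
  rewrite McE => sub; apply: (preimage_h1_compact cB thetaF aff compM).
  by move=> [b' L] /sub[_ /(proj_hext1P b')].
(* Serves twice: it turns compactness into the inclusion, and, once the inclusion has given
   compactness, it supplies the bound for pulling chains back. *)
have lower_bound : compact (h1 @^-1` M) ->
    exists2 c, 0 < c & forall m, M m -> c <= height m.
  exact: (component_height_lower_bound cB thetaF aff compM N0).
split=> //; split; [split|].
- by rewrite NcE.
- rewrite NcE McE => /lower_bound[c c0 hc] [b' L] /hc cL; split => //.
  by apply/(proj_hext1P b'); exact: lt_le_trans c0 cL.
- move=> /compact_of_sub/lower_bound hc; rewrite NcE McE; split => //.
  apply/seteqP; split => [n Mn|p /recMc]; last by rewrite McE.
  exact: (chain_recurrent_of_component cB thetaF aff compM).
Qed.
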